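(* Let $(\mathcal X_1,\mathcal X_2,\mathcal Y,P_{Y|X_1,X_2})$ be a memoryless multiple access channel with finite alphabets, used without feedback, with unreliable strictly causal cribbing from Encoder 1 to Encoder 2. Let $\mathcal I^{\text{strict}}_{\text{mac}}$ be the convex hull of all nonnegative rate quadruples $(R_1,R_1',R_2,R_2'')$ satisfying $$R_1\le I(V;Y|X_2),$$ $$R_2\le I(X_2;Y|V),$$ $$R_1+R_2\le I(V,X_2;Y),$$ $$R_1'\le H(X_1|U,V),$$ $$R_2''\le I(X_2'';Y''|U,V,X_1),$$ $$R_1'+R_2''\le I(X_1,X_2'';Y''|V),$$ $$R_1+R_1'+R_2''\le I(X_1,X_2'';Y''),$$ for some joint distribution $P_{U,V,X_1,X_2,X_2'',Y,Y''}$ of the form $$P_UP_VP_{X_1|U,V}P_{X_2}P_{Y|X_1,X_2}P_{X_2''|U}P_{Y''|X_1,X_2''},$$ where $U,V$ take values in finite sets $\mathcal U,\mathcal V$ with $|\mathcal U|\le\min\{|\mathcal X_1||\mathcal X_2|+1,|\mathcal Y|+2\}$ and $|\mathcal V|\le\min\{|\mathcal X_1||\mathcal X_2|+4,|\mathcal Y|+5\}$. Then $$\mathcal I^{\text{strict}}_{\text{mac}}\subseteq\mathcal C^{\text{strict}}_{\text{mac}},$$ where $\mathcal C^{\text{strict}}_{\text{mac}}$ is the capacity region of the channel with unreliable strictly causal cribbing.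
   Context: Logarithms, entropies and mutual informations are in nats. A multiple access channel (MAC) is a transition probability $P_{Y|X_1,X_2}$ from $\mathcal X_1\times\mathcal X_2$ to $\mathcal Y$ (finite sets), memoryless without feedback: given input sequences $x_1^n,x_2^n$ the output has law $\prod_iP_{Y|X_1,X_2}(y_i|x_{1,i},x_{2,i})$. In joint distributions, $X_2''$ takes values in $\mathcal X_2$, $Y''$ in $\mathcal Y$, and $P_{Y''|X_1,X_2''}$ is the same MAC transition law with $X_2''$ as the second input ($Y''$ is the output when cribbing is present, $Y$ when it is absent). Code. For positive integers $\nu_1,\nu_1',\nu_2,\nu_2''$ let $\mathcal N_1=\{1,\dots,\nu_1\}$, $\mathcal N_1'=\{1,\dots,\nu_1'\}$, $\mathcal N_2=\{1,\dots,\nu_2\}$, $\mathcal N_2''=\{1,\dots,\nu_2''\}$. An $(n,\nu_1,\nu_1',\nu_2,\nu_2'',\epsilon)$ code for the MAC with unreliable strictly causal cribbing consists of encoding maps $f_1:\mathcal N_1\times\mathcal N_1'\to\mathcal X_1^n$, $f_2:\mathcal N_2\to\mathcal X_2^n$ (used by Encoder 2 if cribbing is absent), $f_{2,i}'':\mathcal N_2''\times\mathcal X_1^{i-1}\to\mathcal X_2$, $i=1,\dots,n$ (used by Encoder 2 if cribbing is present), and decoding maps $g:\mathcal Y^n\to\mathcal N_1\times\mathcal N_2$ (cribbing absent) and $g':\mathcal Y^n\to\mathcal N_1\times\mathcal N_1'\times\mathcal N_2''$ (cribbing present), such that $P_e\le\epsilon$ and $P_e'\le\epsilon$. Here $P_e$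 is the average over uniform $(m_1,m_1',m_2)\in\mathcal N_1\times\mathcal N_1'\times\mathcal N_2$ of the probability that $g(Y^n)\ne(m_1,m_2)$ when the inputs are $f_1(m_1,m_1')$ and $f_2(m_2)$; and $P_e'$ is the average over uniform $(m_1,m_1',m_2'')\in\mathcal N_1\times\mathcal N_1'\times\mathcal N_2''$ of the probability that $g'(Y^n)\ne(m_1,m_1',m_2'')$ when the inputs are $x_1^n=f_1(m_1,m_1')$ and the sequence with $i$-th entry $f_{2,i}''(m_2'',x_1^{i-1})$. Achievability. A quadruple $(R_1,R_1',R_2,R_2'')$ of nonnegative reals is achievable if for every $\epsilon>0,\gamma>0$ and all sufficiently large $n$ there is an $(n,\nu_1,\nu_1',\nu_2,\nu_2'',\epsilon)$ code with $\nu_1\ge e^{n(R_1-\gamma)}$, $\nu_1'\ge e^{n(R_1'-\gamma)}$, $\nu_2\ge e^{n(R_2-\gamma)}$, $\nu_2''\ge e^{n(R_2''-\gamma)}$. $\mathcal C^{\text{strict}}_{\text{mac}}$ is the closure of the set of achievable quadruples. *)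

(* Defs.v *)
From mathcomp Require Import all_boot all_order all_algebra.
From mathcomp Require Import all_classical all_reals all_analysis.

Set Implicit Arguments.
Unset Strict Implicit.
Unset Printing Implicit Defensive.

Import Order.TTheory GRing.Theory Num.Theory.
Import numFieldNormedType.Exports.

Local Open Scope classical_set_scope.
Local Open Scope ring_scope.

Section FiniteProbability.
Context {R : realType}.

Definition is_pmf (A : finType) (p : A -> R) : Prop :=
  (forall a, 0 <= p a) /\ \sum_a p a = 1.

(* [K a b] is the conditional probability of [b] given [a]. *)
Definition is_kernel (A B : finType) (K : A -> B -> R) : Prop :=
  forall a, is_pmf (K a).

(* Random variables are functions on a finite sample space [T] carrying the
   mass function [P]. *)
Context {T : finType} (P : T -> R).

Definition prob (A : finType) (X : T -> A) (a : A) : R :=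
  \sum_(t | X t == a) P t.

Definition rvpair (A B : finType) (X : T -> A) (Y : T -> B) (t : T) : A * B :=
  (X t, Y t).

Definition condprob (A C : finType) (X : T -> A) (Z : T -> C) (a : A) (c : C)
  : R := prob (rvpair X Z) (a, c) / prob Z c.

(* In nats.  In the next three sums, terms of probability 0 vanish whatever the
   value of the logarithm, which is the convention 0 log 0 = 0; in the other
   terms all denominators are positive. *)
Definition cond_entropy (A C : finType) (X : T -> A) (Z : T -> C) : R :=
  - \sum_a \sum_c prob (rvpair X Z) (a, c) * ln (condprob X Z a c).

Definition mutual_info (A B : finType) (X : T -> A) (Y : T -> B) : R :=
  \sum_a \sum_b prob (rvpair X Y) (a, b) *
    ln (prob (rvpair X Y) (a, b) / (prob X a * prob Y b)).

Definition cond_mutual_info (A B C : finType)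
    (X : T -> A) (Y : T -> B) (Z : T -> C) : R :=
  \sum_a \sum_b \sum_c prob (rvpair (rvpair X Y) Z) ((a, b), c) *
    ln (condprob (rvpair X Y) Z (a, b) c /
        (condprob X Z a c * condprob Y Z b c)).

End FiniteProbability.

Notation "`H[ P ]( X | Z )" := (cond_entropy P X Z)
  (at level 0, P at level 99, X at level 99, Z at level 99).
Notation "`I[ P ]( X ; Y )" := (mutual_info P X Y)
  (at level 0, P at level 99, X at level 99, Y at level 99).
Notation "`I[ P ]( X ; Y | Z )" := (cond_mutual_info P X Y Z)
  (at level 0, P at level 99, X at level 99, Y at level 99, Z at level 99).

Section MAC.
Context {R : realType} {X1 X2 Y : finType}.

Definition is_mac (W : X1 -> X2 -> Y -> R) : Prop :=
  forall x1 x2, is_pmf (W x1 x2).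

Variable W : X1 -> X2 -> Y -> R.

Definition mac_law (n : nat) (x1 : n.-tuple X1) (x2 : n.-tuple X2)
    (y : n.-tuple Y) : R :=
  \prod_(i < n) W (tnth x1 i) (tnth x2 i) (tnth y i).

(* The symbols strictly before position [i] (positions start at 0). *)
Definition past (n : nat) (A : Type) (x : n.-tuple A) (i : 'I_n) : i.-tuple A :=
  [tuple tnth x (widen_ord (ltnW (ltn_ord i)) j) | j < i].

(* A double prime in the mathematics is written [c] (for cribbing) here and
   below: nu2c, R2c, X2c, Yc stand for nu_2'', R_2'', X_2'', Y''. *)
Record mac_code (n nu1 nu1' nu2 nu2c : nat) := MacCode {
  enc1 : 'I_nu1 -> 'I_nu1' -> n.-tuple X1;
  enc2 : 'I_nu2 -> n.-tuple X2;
  enc2c : forall i : 'I_n, 'I_nu2c -> i.-tuple X1 -> X2;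
  dec : n.-tuple Y -> 'I_nu1 * 'I_nu2;
  dec' : n.-tuple Y -> 'I_nu1 * 'I_nu1' * 'I_nu2c }.

Section Errors.
Context {n nu1 nu1' nu2 nu2c : nat} (c : mac_code n nu1 nu1' nu2 nu2c).

Definition crib_input (m2c : 'I_nu2c) (x1 : n.-tuple X1) : n.-tuple X2 :=
  [tuple enc2c c m2c (past x1 i) | i < n].

Definition error_absent : R :=
  (\sum_(m1 < nu1) \sum_(m1' < nu1') \sum_(m2 < nu2)
     \sum_(y : n.-tuple Y | dec c y != (m1, m2))
        mac_law (enc1 c m1 m1') (enc2 c m2) y)
  / (nu1 * nu1' * nu2)%:R.

Definition error_present : R :=
  (\sum_(m1 < nu1) \sum_(m1' < nu1') \sum_(m2c < nu2c)
     \sum_(y : n.-tuple Y | dec' c y != (m1, m1', m2c))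
        mac_law (enc1 c m1 m1') (crib_input m2c (enc1 c m1 m1')) y)
  / (nu1 * nu1' * nu2c)%:R.

End Errors.

(* The quadruple (R1, R1', R2, R2c); [R^o] is [R] seen as a module over itself,
   which provides the vector space structure on quadruples. *)
Local Notation rates := (R^o * R^o * R^o * R^o)%type.

Definition nonneg_rates (r : rates) : Prop :=
  let: (R1, R1', R2, R2c) := r in
  [/\ 0 <= R1, 0 <= R1', 0 <= R2 & 0 <= R2c].

Definition achievable (r : rates) : Prop :=
  let: (R1, R1', R2, R2c) := r in
  nonneg_rates r /\
  forall eps gamma : R, 0 < eps -> 0 < gamma ->
  \forall n \near \oo,
  exists nu1 nu1' nu2 nu2c : nat,
    [/\ [/\ (0 < nu1)%N, (0 < nu1')%N, (0 < nu2)%N & (0 < nu2c)%N],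
        [/\ expR (n%:R * (R1 - gamma)) <= nu1%:R,
            expR (n%:R * (R1' - gamma)) <= nu1'%:R,
            expR (n%:R * (R2 - gamma)) <= nu2%:R &
            expR (n%:R * (R2c - gamma)) <= nu2c%:R] &
        exists c : mac_code n nu1 nu1' nu2 nu2c,
          error_absent c <= eps /\ error_present c <= eps].

Definition capacity_region : set rates := closure [set r | achievable r].

Section JointLaw.
Context {U V : finType}.

(* Sample points are (u, v, x1, x2, x2c, y, yc). *)
Local Notation omega := (U * V * X1 * X2 * X2 * Y * Y)%type.

Definition rvU (t : omega) : U := let: (u, _, _, _, _, _, _) := t in u.
Definition rvV (t : omega) : V := let: (_, v, _, _, _, _, _) := t in v.
Definition rvX1 (t : omega) : X1 := let: (_, _, x1, _, _, _, _) := t in x1.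
Definition rvX2 (t : omega) : X2 := let: (_, _, _, x2, _, _, _) := t in x2.
Definition rvX2c (t : omega) : X2 := let: (_, _, _, _, x2c, _, _) := t in x2c.
Definition rvY (t : omega) : Y := let: (_, _, _, _, _, y, _) := t in y.
Definition rvYc (t : omega) : Y := let: (_, _, _, _, _, _, yc) := t in yc.

Definition admissible (P : omega -> R) : Prop :=
  exists (PU : U -> R) (PV : V -> R) (PX1 : U * V -> X1 -> R)
         (PX2 : X2 -> R) (PX2c : U -> X2 -> R),
    [/\ is_pmf PU, is_pmf PV, is_kernel PX1, is_pmf PX2 & is_kernel PX2c] /\
    forall u v x1 x2 x2c y yc,
      P (u, v, x1, x2, x2c, y, yc) =
      PU u * PV v * PX1 (u, v) x1 * PX2 x2 * W x1 x2 y
        * PX2c u x2c * W x1 x2c yc.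

Definition rate_constraints (P : omega -> R) (r : rates) : Prop :=
  let: (R1, R1', R2, R2c) := r in
  [/\ [/\ R1 <= `I[P](rvV ; rvY | rvX2),
          R2 <= `I[P](rvX2 ; rvY | rvV) &
          R1 + R2 <= `I[P](rvpair rvV rvX2 ; rvY)],
      R1' <= `H[P](rvX1 | rvpair rvU rvV),
      R2c <= `I[P](rvX2c ; rvYc | rvpair (rvpair rvU rvV) rvX1),
      R1' + R2c <= `I[P](rvpair rvX1 rvX2c ; rvYc | rvV) &
      R1 + R1' + R2c <= `I[P](rvpair rvX1 rvX2c ; rvYc)].

End JointLaw.

Definition single_letter_rates : set rates :=
  [set r | nonneg_rates r /\
    exists (U V : finType) (P : U * V * X1 * X2 * X2 * Y * Y -> R),
      [/\ (#|U| <= minn (#|X1| * #|X2| + 1) (#|Y| + 2))%N,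
          (#|V| <= minn (#|X1| * #|X2| + 4) (#|Y| + 5))%N,
          admissible P &
          rate_constraints P r]].

Definition inner_region : set rates :=
  smallest (@convex_set R rates) single_letter_rates.

End MAC.

(* Main.v *)
Require Import Defs.
From mathcomp Require Import all_boot all_order all_algebra.
From mathcomp Require Import all_classical all_reals all_analysis.
From mathcomp Require Import ring lra.

(** Block-Markov coding with backward decoding.  In each block, words [u k],
    [v m1], [x1 (k, m1, m')], [x2 m2] and [xc (k, mc)] are used, where
    [m1 = (ma, mb)] and the state [k] is the pair [(ma, m')] of the previous block.
    Encoder 2 sees [x1], recovers [m1] and [m'] from it, hence knows the next state.
    Without cribbing a block is an ordinary MAC with inputs [v] and [x2].  With
    cribbing the decoder goes through the blocks backward: knowing [(ma, m')], which
    is the state of the next block, it finds [mb] by means of [v] only, and then [k]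
    and [mc].  If [mb] has rate max(0, R1 + R1' + R2c - I(X1,X2c;Yc|V)), which is at
    most I(V;Yc) by the chain rule, all decoding conditions follow from the rate
    constraints; for Encoder 2 one uses I(V;Y|X2) <= I(V;X1).

    A single code serves for all blocks: its errors are averaged over uniform initial
    and final states, so concatenation costs a union bound, and the outermost states
    are fixed at the end.  Concatenation of codes without state is time sharing, which
    gives the convex hull. *)

(** If the whole of [m1] belonged to the state, the decoder with cribbing would know [v] before
    decoding a block, and would have to find [k] and [mc] at total rate R1 + R1' + R2c below
    I(X1,X2c;Yc|V), which the rate constraints do not grant. Hence the split of [m1]: [mb] stays out
    of the state and is paid for by I(V;Yc). As [v] does not depend on the state, the decoder
    without cribbing can treat each block alone.

    In a code for one block, [(ma, m')] is not a message but the final state. Concatenation turns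
    the states in the middle into messages; they are then uniform, as the error average of each
    block requires, and [B + 1] blocks carry [B] of them.

    Typicality is replaced by scores: a candidate passes when a density ratio times a constant is at
    least 1. A change of measure bounds the mean score of an independent rival, and the weak law of
    large numbers lets the true candidate pass. The random coding bound is therefore stated for
    abstract finite alphabets and used with words as letters. *)

Set Implicit Arguments.
Unset Strict Implicit.
Unset Printing Implicit Defensive.

Import Order.TTheory GRing.Theory Num.Theory.
Import numFieldNormedType.Exports.

Local Open Scope classical_set_scope.
Local Open Scope ring_scope.

(** * Sums over words and random words *)

Section Sums.
Context {R : realType}.

Lemma sum_tuple_prod (n : nat) (A : finType) (F : 'I_n -> A -> R) :
  \sum_(t : n.-tuple A) \prod_i F i (tnth t i) = \prod_i \sum_a F i a.
Proof.
rewrite bigA_distr_bigA (reindex (fun f : {ffun 'I_n -> A} => [tuple f i | i < n])) /=.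
  by apply: eq_bigr => f _; apply: eq_bigr => i _; rewrite tnth_mktuple.
exists (fun t => [ffun i => tnth t i]) => f _.
  by apply/ffunP => i; rewrite ffunE tnth_mktuple.
by apply: eq_from_tnth => i; rewrite tnth_mktuple ffunE.
Qed.

Lemma sum_tuple_prodM (n : nat) (A : finType) (F G : 'I_n -> A -> R) :
  \sum_(t : n.-tuple A) (\prod_i F i (tnth t i)) * (\prod_i G i (tnth t i)) =
  \prod_i \sum_a F i a * G i a.
Proof. by rewrite -sum_tuple_prod; apply: eq_bigr => t _; rewrite big_split. Qed.

Lemma sum_cat_tuple (m n : nat) (A : finType) (F : (m + n).-tuple A -> R) :
  \sum_t F t = \sum_(s : m.-tuple A) \sum_(t : n.-tuple A) F [tuple of s ++ t].
Proof.
rewrite pair_bigA /= (reindex (fun p : m.-tuple A * n.-tuple A =>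
  [tuple of p.1 ++ p.2])) //=.
exists (fun t => ([tuple tnth t (lshift n i) | i < m],
                  [tuple tnth t (rshift m i) | i < n])) => [[s t]|t] _.
  by congr pair; apply: eq_from_tnth => i;
    rewrite tnth_mktuple (tnth_lshift, tnth_rshift).
by apply: eq_from_tnth => i; case: (split_ordP i) => j ->;
  rewrite (tnth_lshift, tnth_rshift) tnth_mktuple.
Qed.

Lemma sum_delta (A : finType) (a : A) (F : A -> R) :
  \sum_b (a == b)%:R * F b = F a.
Proof.
rewrite (bigD1 a) //= eqxx mul1r big1 ?addr0// => b.
by rewrite eq_sym => /negbTE ->; rewrite mul0r.
Qed.

Lemma sum_prod5 (A B C D E : finType) (F : A * B * C * D * E -> R) :
  \sum_s F s = \sum_a \sum_b \sum_c \sum_d \sum_e F (a, b, c, d, e).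
Proof. by rewrite !pair_bigA /=; apply: eq_bigr => -[[[[]]]]. Qed.

Lemma sum_prod7 (A B C D E G H : finType) (F : A * B * C * D * E * G * H -> R) :
  \sum_s F s =
  \sum_a \sum_b \sum_c \sum_d \sum_e \sum_g \sum_h F (a, b, c, d, e, g, h).
Proof. by rewrite !pair_bigA /=; apply: eq_bigr => -[[[[[[]]]]]]. Qed.

End Sums.

Section RandomWord.
Context {R : realType} {I A : finType}.
Implicit Types (p : I -> A -> R) (F : {ffun I -> A} -> R).

Definition expect p F : R := \sum_(f : {ffun I -> A}) (\prod_i p i (f i)) * F f.

(* [tilt e a q F] is the mean of [F] at a letter drawn from [q], or at the
   letter [a] itself when [e] says that both letters are the same one. *)
Definition tilt (e : bool) (a : A) (q : A -> R) (F : A -> R) : R :=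
  if e then F a else \sum_b q b * F b.

Definition tilt_mass (e : bool) (a : A) (q : A -> R) (b : A) : R :=
  if e then (a == b)%:R else q b.

Lemma tiltE e a q (G : A -> R) :
  \sum_b tilt_mass e a q b * G b = tilt e a q G.
Proof. by rewrite /tilt /tilt_mass; case: e; rewrite ?sum_delta. Qed.

(** The indicators pin the letters at [i] and [j], and all others integrate to 1. [F] need only be
    constant once these two letters are fixed, so it may itself be an expectation that depends on
    the word; this permits nesting. *)
Lemma expect_delta p i j a b F (c : R) : is_kernel p ->
  (forall f : {ffun I -> A}, f i = a -> f j = b -> F f = c) ->
  expect p (fun f : {ffun I -> A} => (f i == a)%:R * (f j == b)%:R * F f) =
  p i a * tilt_mass (i == j) a (p j) b * c.
Proof.
move=> kp Fc; rewrite /expect.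
(* [h] distributes the two indicators over the positions, so that the summand becomes a product over
   positions. *)
pose h (k : I) (x : A) : R := ((k == i) ==> (x == a))%:R * ((k == j) ==> (x == b))%:R.
transitivity (\sum_(f : {ffun I -> A}) (\prod_k (p k (f k) * h k (f k))) * c).
  apply: eq_bigr => f _; rewrite big_split /= -!mulrA; congr (_ * _).
  have -> : \prod_k h k (f k) = (f i == a)%:R * (f j == b)%:R.
    rewrite big_split /=; congr (_ * _).
      rewrite (bigD1 i) //= eqxx big1 ?mulr1// => k /negbTE ->; exact: erefl.
    by rewrite (bigD1 j) //= eqxx big1 ?mulr1// => k /negbTE ->.
  case: eqP => [fa|_]; last by rewrite !mul0r.
  case: eqP => [fb|_]; last by rewrite !(mul0r, mulr0).
  by rewrite !mul1r (Fc f).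
rewrite -big_distrl /= -(bigA_distr_bigA (fun k x => p k x * h k x)); congr (_ * _).
have other k : k != i -> k != j -> \sum_x p k x * h k x = 1.
  move=> /negbTE ki /negbTE kj; rewrite -(kp k).2; apply: eq_bigr => x _.
  by rewrite /h ki kj !mulr1.
rewrite (bigD1 i) //= /tilt_mass; case: (eqVneq i j) => [eij|ij].
  subst j; rewrite [\prod_(_ | _) _]big1 ?mulr1 => [|k ki]; last by apply: other.
  rewrite (bigD1 a) //= /h !eqxx /= big1 => [|x /negbTE ->]; last by rewrite !(mul0r, mulr0).
  by rewrite addr0 mul1r.
rewrite (bigD1 j) 1?eq_sym //= [\prod_(_ | _) _]big1 => [|k /andP[ki kj]]; last exact: other.
rewrite mulr1; congr (_ * _).
  rewrite (bigD1 a) //= /h !eqxx (negbTE ij) /= big1 => [|x /negbTE ->].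
    by rewrite addr0 !mulr1.
  by rewrite !(mul0r, mulr0).
rewrite (bigD1 b) //= /h !eqxx eq_sym (negbTE ij) /= big1 => [|x /negbTE ->].
  by rewrite addr0 !mulr1.
by rewrite !(mul0r, mulr0).
Qed.

End RandomWord.

(** * Random codebooks *)

Section JointLaw.
Context {R : realType} {U V X1 X2 Y : finType}.
Variables (PU : U -> R) (PV : V -> R) (PX1 : U * V -> X1 -> R)
  (PX2 : X2 -> R) (PX2c : U -> X2 -> R) (W : X1 -> X2 -> Y -> R).

Definition joint_law (t : U * V * X1 * X2 * X2 * Y * Y) : R :=
  let: (u, v, x1, x2, x2c, y, yc) := t in
  PU u * PV v * PX1 (u, v) x1 * PX2 x2 * W x1 x2 y * PX2c u x2c * W x1 x2c yc.

End JointLaw.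

Section Codebook.
Context {R : realType} {U V X1 X2 Y : finType}.
Variables (PU : U -> R) (PV : V -> R) (PX1 : U * V -> X1 -> R)
  (PX2 : X2 -> R) (PX2c : U -> X2 -> R) (W : X1 -> X2 -> Y -> R).
Hypotheses (hU : is_pmf PU) (hV : is_pmf PV) (hX1 : is_kernel PX1)
  (hX2 : is_pmf PX2) (hX2c : is_kernel PX2c) (hW : is_mac W).
Context {K M1 M' M2 Mc : finType}.

Local Notation letters := (U * V * X1 * X2 * X2)%type.
Local Notation omega := (U * V * X1 * X2 * X2 * Y * Y)%type.
Local Notation index := (K * M1 * M' * M2 * Mc)%type.
Local Notation law := (joint_law PU PV PX1 PX2 PX2c W).

(** Superposition coding: [x1] and [xc] share the centre [u] of the state, which is how the encoders
    cooperate. The alphabets are arbitrary finite types, later sets of words, so a codeword counts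
    here as a single letter. *)
Definition codebook : finType :=
  ({ffun K -> U} * {ffun M1 -> V} * {ffun K * M1 * M' -> X1} *
   {ffun M2 -> X2} * {ffun K * Mc -> X2})%type.

Definition codeword (cb : codebook) (i : index) : letters :=
  let: (u, v, x1, x2, xc) := cb in let: (k, m1, m', m2, mc) := i in
  (u k, v m1, x1 (k, m1, m'), x2 m2, xc (k, mc)).

Definition codebook_law (cb : codebook) : R :=
  let: (u, v, x1, x2, xc) := cb in
  (\prod_i PU (u i)) * (\prod_i PV (v i)) *
  (\prod_i PX1 (u i.1.1, v i.1.2) (x1 i)) *
  (\prod_i PX2 (x2 i)) * (\prod_i PX2c (u i.1) (xc i)).

Definition letters_law (s : letters) : R :=
  let: (u, v, x1, x2, xc) := s in
  PU u * PV v * PX1 (u, v) x1 * PX2 x2 * PX2c u xc.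

Definition rival_law (i j : index) (s s' : letters) : R :=
  let: (u, v, x1, x2, xc) := s in let: (u', v', x1', x2', xc') := s' in
  let: (k, m1, m', m2, mc) := i in let: (l, n1, n', n2, nc) := j in
  tilt_mass (k == l) u PU u' * tilt_mass (m1 == n1) v PV v' *
  tilt_mass ((k, m1, m') == (l, n1, n')) x1 (PX1 (u', v')) x1' *
  tilt_mass (m2 == n2) x2 PX2 x2' *
  tilt_mass ((k, mc) == (l, nc)) xc (PX2c u') xc'.

(* Mean of [F] over the codeword of index [j] given that the codeword of index
   [i] is [s]; the letters with a common index coincide. *)
Definition rival_mean (i j : index) (s : letters) (F : letters -> R) : R :=
  let: (u, v, x1, x2, xc) := s in
  let: (k, m1, m', m2, mc) := i in let: (l, n1, n', n2, nc) := j in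
  tilt (k == l) u PU (fun u' => tilt (m1 == n1) v PV (fun v' =>
  tilt ((k, m1, m') == (l, n1, n')) x1 (PX1 (u', v')) (fun x1' =>
  tilt (m2 == n2) x2 PX2 (fun x2' =>
  tilt ((k, mc) == (l, nc)) xc (PX2c u') (fun xc' =>
    F (u', v', x1', x2', xc')))))).

Lemma rival_meanE i j s F :
  \sum_s' rival_law i j s s' * F s' = rival_mean i j s F.
Proof.
case: s i j => [[[[u v] x1] x2] xc] [[[[k m1] m'] m2] mc] [[[[l n1] n'] n2] nc].
rewrite sum_prod5 /rival_law /rival_mean -tiltE; apply: eq_bigr => u' _.
rewrite -tiltE big_distrr; apply: eq_bigr => v' _ /=.
rewrite mulrA -tiltE big_distrr; apply: eq_bigr => x1' _ /=.
rewrite mulrA -tiltE big_distrr; apply: eq_bigr => x2' _ /=.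
rewrite mulrA -tiltE big_distrr; apply: eq_bigr => xc' _ /=.
by rewrite mulrA.
Qed.

Lemma codebook_law_delta i j s s' :
  \sum_cb codebook_law cb * ((codeword cb i == s)%:R * (codeword cb j == s')%:R) =
  letters_law s * rival_law i j s s'.
Proof.
case: s s' i j => [[[[u0 v0] a0] b0] c0] [[[[u1 v1] a1] b1] c1].
move=> [[[[k m1] m'] m2] mc] [[[[l n1] n'] n2] nc].
(* One nested expectation per family, in the order [u], [v], [x1], [x2], [xc]; once evaluated, the
   inner ones retain only the pinned letters of [u] and [v], as [expect_delta] demands. *)
pose e5 (u : {ffun K -> U}) := expect (fun i : K * Mc => PX2c (u i.1))
  (fun xc : {ffun K * Mc -> X2} =>
    (xc (k, mc) == c0)%:R * (xc (l, nc) == c1)%:R * 1).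
pose e4 u := expect (fun _ : M2 => PX2)
  (fun x2 : {ffun M2 -> X2} => (x2 m2 == b0)%:R * (x2 n2 == b1)%:R * e5 u).
pose e3 (u : {ffun K -> U}) (v : {ffun M1 -> V}) :=
  expect (fun i : K * M1 * M' => PX1 (u i.1.1, v i.1.2))
  (fun x1 : {ffun K * M1 * M' -> X1} =>
    (x1 (k, m1, m') == a0)%:R * (x1 (l, n1, n') == a1)%:R * e4 u).
pose e2 u := expect (fun _ : M1 => PV)
  (fun v : {ffun M1 -> V} => (v m1 == v0)%:R * (v n1 == v1)%:R * e3 u v).
transitivity (expect (fun _ : K => PU)
  (fun u : {ffun K -> U} => (u k == u0)%:R * (u l == u1)%:R * e2 u)).
  rewrite sum_prod5 /e2 /e3 /e4 /e5 /expect; apply: eq_bigr => u _.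
  rewrite 2!big_distrr /=; apply: eq_bigr => v _.
  rewrite 4!big_distrr /=; apply: eq_bigr => x1 _.
  rewrite 6!big_distrr /=; apply: eq_bigr => x2 _.
  rewrite 8!big_distrr /=; apply: eq_bigr => xc _.
  rewrite /codebook_law !xpair_eqE -!mulnb !natrM; ring.
rewrite /letters_law /rival_law.
transitivity (PU u0 * tilt_mass (k == l) u0 PU u1 *
  (PV v0 * tilt_mass (m1 == n1) v0 PV v1 *
  (PX1 (u0, v0) a0 *
   tilt_mass ((k, m1, m') == (l, n1, n')) a0 (PX1 (u1, v1)) a1 *
  (PX2 b0 * tilt_mass (m2 == n2) b0 PX2 b1 *
  (PX2c u0 c0 * tilt_mass ((k, mc) == (l, nc)) c0 (PX2c u1) c1 * 1)))));
  last by ring.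
apply: expect_delta => [|u uk ul]; first by move=> _.
apply: expect_delta => [|v vm vn]; first by move=> _.
rewrite -uk -ul -vm -vn /e3.
apply: (@expect_delta _ _ _ (fun i : K * M1 * M' => PX1 (u i.1.1, v i.1.2))
   (k, m1, m') (l, n1, n')) => [i|x1 _ _]; first exact: hX1.
apply: expect_delta => [|x2 _ _]; first by move=> _.
apply: (@expect_delta _ _ _ (fun i : K * Mc => PX2c (u i.1)) (k, mc) (l, nc))
  => [i|xc _ _ //]; exact: hX2c.
Qed.

Lemma codebook_law_ge0 cb : 0 <= codebook_law cb.
Proof.
case: cb => [[[[u v] x1] x2] xc] /=.
by rewrite !mulr_ge0 //; apply: prodr_ge0 => i _;
  [exact: hU.1|exact: hV.1|exact: (hX1 _).1|exact: hX2.1|exact: (hX2c _).1].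
Qed.

(** A union bound compares the true codeword with one rival at a time, so the joint law of two
    codewords is all that is asked of the random codebook. *)
Lemma expect_codewords i j (G : letters -> letters -> R) :
  \sum_cb codebook_law cb * G (codeword cb i) (codeword cb j) =
  \sum_s letters_law s * rival_mean i j s (G s).
Proof.
under [RHS]eq_bigr => s _ do rewrite -rival_meanE big_distrr /=.
under [RHS]eq_bigr => s _ do under eq_bigr => s' _ do
  rewrite mulrA -codebook_law_delta big_distrl /=.
under [RHS]eq_bigr => s _ do rewrite exchange_big /=.
rewrite [RHS]exchange_big /=; apply: eq_bigr => cb _.
under [RHS]eq_bigr => s _ do under eq_bigr => s' _ do rewrite -!mulrA.
under [RHS]eq_bigr => s _ do rewrite -!big_distrr /=.
rewrite -big_distrr /= sum_delta; congr (_ * _).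
by rewrite sum_delta.
Qed.

Lemma codebook_law_sum1 (i : index) : \sum_cb codebook_law cb = 1.
Proof.
have := expect_codewords i i (fun _ _ => 1).
under eq_bigr do rewrite mulr1.
move->; rewrite sum_prod5 /rival_mean -[RHS]hU.2; apply: eq_bigr => u _.
case: i => [[[[k m1] m'] m2] mc]; rewrite /tilt !eqxx /letters_law.
under eq_bigr => v _ do under eq_bigr => x1 _ do under eq_bigr => x2 _ do
  rewrite -big_distrl -big_distrr /= (hX2c _).2 !mulr1.
under eq_bigr => v _ do under eq_bigr => x1 _ do rewrite -big_distrr /= hX2.2 mulr1.
under eq_bigr => v _ do rewrite -big_distrr /= (hX1 _).2 mulr1.
by rewrite -big_distrr /= hV.2 mulr1.
Qed.

Definition with_outputs (s : letters) (y yc : Y) : omega :=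
  let: (u, v, x1, x2, xc) := s in (u, v, x1, x2, xc, y, yc).

Definition inputs (t : omega) : letters :=
  let: (u, v, x1, x2, xc, _, _) := t in (u, v, x1, x2, xc).

(** The outputs of both modes are drawn for the same codebook: one mean then bounds all errors, and
    one codebook serves with and without cribbing. *)
Definition outputs_law (s : letters) (y yc : Y) : R :=
  let: (_, _, x1, x2, xc) := s in W x1 x2 y * W x1 xc yc.

Definition ensemble_law (i : index) (p : codebook * Y * Y) : R :=
  codebook_law p.1.1 * outputs_law (codeword p.1.1 i) p.1.2 p.2.

Definition observed (i : index) (p : codebook * Y * Y) : omega :=
  with_outputs (codeword p.1.1 i) p.1.2 p.2.

Lemma sum_ensemble i (F : codebook * Y * Y -> R) :
  \sum_p ensemble_law i p * F p = \sum_cb codebook_law cb *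
    (\sum_y \sum_yc outputs_law (codeword cb i) y yc * F (cb, y, yc)).
Proof.
transitivity (\sum_cb \sum_y \sum_yc ensemble_law i (cb, y, yc) * F (cb, y, yc)).
  by rewrite !pair_bigA /=; apply: eq_bigr => -[[]].
apply: eq_bigr => cb _; rewrite big_distrr /=; apply: eq_bigr => y _.
by rewrite big_distrr /=; apply: eq_bigr => yc _; rewrite mulrA.
Qed.

Lemma expect_ensemble i j (G : omega -> letters -> R) :
  \sum_p ensemble_law i p * G (observed i p) (codeword p.1.1 j) =
  \sum_t law t * rival_mean i j (inputs t) (G t).
Proof.
rewrite (sum_ensemble i (fun p => G (observed i p) (codeword p.1.1 j))) /=.
rewrite (expect_codewords i j (fun s s' => \sum_y \sum_yc
  outputs_law s y yc * G (with_outputs s y yc) s')).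
transitivity (\sum_s \sum_y \sum_yc law (with_outputs s y yc) *
  rival_mean i j s (G (with_outputs s y yc))); last first.
  by rewrite !pair_bigA /=; apply: eq_bigr => -[[[[[[u v] x1] x2] xc] y] yc] _.
apply: eq_bigr => s _; rewrite -rival_meanE.
under eq_bigr => s' _ do rewrite big_distrr /=.
rewrite exchange_big big_distrr /=; apply: eq_bigr => y _.
under eq_bigr => s' _ do rewrite big_distrr /=.
rewrite exchange_big big_distrr /=; apply: eq_bigr => yc _.
rewrite -rival_meanE !big_distrr /=; apply: eq_bigr => s' _.
case: s => [[[[u v] x1] x2] xc]; rewrite /letters_law /outputs_law /joint_law /=.
by ring.
Qed.

Lemma expect_observed i (F : omega -> R) :
  \sum_p ensemble_law i p * F (observed i p) = \sum_t law t * F t.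
Proof.
rewrite (expect_ensemble i i (fun t _ => F t)); apply: eq_bigr => t _.
case: i t => [[[[k m1] m'] m2] mc] [[[[[[u v] x1] x2] xc] y] yc].
by rewrite /rival_mean /tilt !eqxx.
Qed.

Lemma expect_rivals i (J : finType) (D : pred J) (j : J -> index)
    (g : omega -> letters -> R) (c : R) :
  (forall l, D l -> \sum_t law t * rival_mean i (j l) (inputs t) (g t) <= c) ->
  \sum_p ensemble_law i p *
    (\sum_(l | D l) g (observed i p) (codeword p.1.1 (j l))) <= #|D|%:R * c.
Proof.
move=> gc; under eq_bigr => p _ do rewrite big_distrr /=.
rewrite exchange_big /= -sum1_card natr_sum big_distrl /=; apply: ler_sum => l Dl.
by rewrite expect_ensemble mul1r; exact: gc.
Qed.

End Codebook.

(** * One-shot achievability *)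

Definition pickd (T : finType) (t0 : T) (P : pred T) : T := odflt t0 [pick t | P t].

(** If the pick is wrong, either nothing passes the test, in particular not [t], or some rival
    passes; [a] and [b] pay for these two cases. *)
Lemma pickd_error (R : realType) (T : finType) (t0 t : T) (P : pred T) (a b : R) :
  0 <= a -> 0 <= b -> (~~ P t -> 1 <= a) ->
  (forall t', t' != t -> P t' -> 1 <= b) ->
  (pickd t0 P != t)%:R <= a + b.
Proof.
move=> a0 b0 Pta Pb; rewrite /pickd; case: pickP => [t' Pt'|P0] /=.
  case: eqVneq => [_|tt']; first exact: addr_ge0.
  by rewrite (le_trans (Pb _ tt' Pt')) // lerDr.
rewrite (@le_trans _ _ 1) ?lern1 ?leq_b1 //.
by rewrite (le_trans (Pta (negbT (P0 t)))) // lerDl.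
Qed.

Lemma le1_sum (R : realType) (T : finType) (D : pred T) (F : T -> R) (t : T) :
  (forall t', 0 <= F t') -> D t -> 1 <= F t -> 1 <= \sum_(t' | D t') F t'.
Proof.
move=> F0 Dt Ft; rewrite (bigD1 t) //= (le_trans Ft) // lerDl.
by apply: sumr_ge0 => t' _.
Qed.

(** If [F] exceeded [c] everywhere, the nonnegative terms [w t * (F t - c)] would have sum at most
    0, which forces every weight to vanish. *)
Lemma exists_le_mean (R : realType) (T : finType) (w F : T -> R) (c : R) :
  (forall t, 0 <= w t) -> \sum_t w t = 1 -> \sum_t w t * F t <= c ->
  exists t, F t <= c.
Proof.
move=> w0 w1 wF; apply: contrapT => nF.
have lF t : c < F t by rewrite ltNge; apply/negP => le; apply: nF; exists t.
have d0 t : true -> 0 <= w t * (F t - c).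
  by move=> _; rewrite mulr_ge0 // subr_ge0 ltW.
have sd : \sum_t w t * (F t - c) = 0.
  apply/eqP; rewrite eq_le sumr_ge0 // andbT.
  under eq_bigr do rewrite mulrBr.
  by rewrite sumrB -big_distrl /= w1 mul1r subr_le0.
have : \sum_t w t = 0.
  apply: big1 => t _; have /eqP := psumr_eq0P d0 sd (i:=t) erefl.
  by rewrite mulf_eq0 subr_eq0 (gt_eqF (lF t)) orbF => /eqP.
by rewrite w1 => /eqP; rewrite oner_eq0.
Qed.

Section OneShot.
Context {R : realType} {U V X1 X2 Y : finType}.
Variables (PU : U -> R) (PV : V -> R) (PX1 : U * V -> X1 -> R)
  (PX2 : X2 -> R) (PX2c : U -> X2 -> R) (W : X1 -> X2 -> Y -> R).
Hypotheses (hU : is_pmf PU) (hV : is_pmf PV) (hX1 : is_kernel PX1)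
  (hX2 : is_pmf PX2) (hX2c : is_kernel PX2c) (hW : is_mac W).
Context {Ka Kb Mb M2 Mc : finType}.

Local Notation K := (Ka * Kb)%type.
Local Notation M1 := (Ka * Mb)%type.
Local Notation letters := (U * V * X1 * X2 * X2)%type.
Local Notation omega := (U * V * X1 * X2 * X2 * Y * Y)%type.
Local Notation index := (K * M1 * Kb * M2 * Mc)%type.
Local Notation law := (joint_law PU PV PX1 PX2 PX2c W).
Local Notation cbook := (@codebook U V X1 X2 K M1 Kb M2 Mc).

(** Scores of candidates; the letter tells who decodes (A: decoder without cribbing, C: Encoder 2,
    B: decoder with cribbing), the number which coordinates are wrong. A candidate passes if its
    scores reach 1, so by Markov's inequality the mean score of an independent rival bounds its
    chance to pass. *)
Variables (dA1 dA2 dA3 : V -> X2 -> Y -> R) (dC1 : V -> X1 -> R)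
  (dC2 : U -> V -> X1 -> R) (dB1 : V -> Y -> R) (dB2 : V -> X1 -> X2 -> Y -> R)
  (dB3 : U -> V -> X1 -> X2 -> Y -> R).
Hypotheses (dA1_ge0 : forall v x2 y, 0 <= dA1 v x2 y)
  (dA2_ge0 : forall v x2 y, 0 <= dA2 v x2 y)
  (dA3_ge0 : forall v x2 y, 0 <= dA3 v x2 y)
  (dC1_ge0 : forall v x1, 0 <= dC1 v x1)
  (dC2_ge0 : forall u v x1, 0 <= dC2 u v x1)
  (dB1_ge0 : forall v y, 0 <= dB1 v y)
  (dB2_ge0 : forall v x1 x2 y, 0 <= dB2 v x1 x2 y)
  (dB3_ge0 : forall u v x1 x2 y, 0 <= dB3 u v x1 x2 y).
Variables cA1 cA2 cA3 cC1 cC2 cB1 cB2 cB3 : R.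
Hypotheses
  (hA1 : \sum_t law t * (\sum_v PV v * dA1 v (rvX2 t) (rvY t)) <= cA1)
  (hA2 : \sum_t law t * (\sum_x2 PX2 x2 * dA2 (rvV t) x2 (rvY t)) <= cA2)
  (hA3 : \sum_t law t * (\sum_v PV v * \sum_x2 PX2 x2 * dA3 v x2 (rvY t)) <= cA3)
  (hC1 : \sum_t law t * (\sum_v PV v * dC1 v (rvX1 t)) <= cC1)
  (hC2 : \sum_t law t * (PX1 (rvU t, rvV t) (rvX1 t) *
            dC2 (rvU t) (rvV t) (rvX1 t)) <= cC2)
  (hB1 : \sum_t law t * (\sum_v PV v * dB1 v (rvYc t)) <= cB1)
  (hB2 : \sum_t law t * (\sum_u PU u * \sum_x1 PX1 (u, rvV t) x1 *
            \sum_xc PX2c u xc * dB2 (rvV t) x1 xc (rvYc t)) <= cB2)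
  (hB3 : \sum_t law t * (\sum_xc PX2c (rvU t) xc *
            dB3 (rvU t) (rvV t) (rvX1 t) xc (rvYc t)) <= cB3).

Let testA v x2 y := [&& 1 <= dA1 v x2 y, 1 <= dA2 v x2 y & 1 <= dA3 v x2 y].
Let testC u v x1 := (1 <= dC1 v x1) && (1 <= dC2 u v x1).
Let testB u v x1 x2 y :=
  [&& 1 <= dB1 v y, 1 <= dB2 v x1 x2 y & 1 <= dB3 u v x1 x2 y].

Let atypical (t : omega) : R :=
  let: (u, v, x1, x2, xc, y, yc) := t in
  ((dA1 v x2 y < 1)%R%:R + (dA2 v x2 y < 1)%R%:R + (dA3 v x2 y < 1)%R%:R) +
  ((dC1 v x1 < 1)%R%:R + (dC2 u v x1 < 1)%R%:R) +
  ((dB1 v yc < 1)%R%:R + (dB2 v x1 xc yc < 1)%R%:R +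
   (dB3 u v x1 xc yc < 1)%R%:R).

Hypotheses (cA3_ge0 : 0 <= cA3) (cB2_ge0 : 0 <= cB2).

(** [gC] is given the true initial state and [gB] the true final state: the propagation of errors
    between blocks is left to the concatenation. *)
Definition block_fail (x1 : K * M1 * Kb -> X1) (x2 : M2 -> X2) (xc : K * Mc -> X2)
    (gA : Y -> M1 * M2) (gC : K -> X1 -> K) (gB : Y -> K -> Mb * K * Mc)
    (i : index) : R :=
  let: (k, m1, m', m2, mc) := i in let x := x1 (k, m1, m') in
  (gC k x != (m1.1, m'))%:R + \sum_(y | gA y != (m1, m2)) W x (x2 m2) y +
  \sum_(y | gB y (m1.1, m') != (m1.2, k, mc)) W x (xc (k, mc)) y.

Let gA1 (t : omega) (s : letters) : R :=
  let: (_, v, _, _, _) := s in dA1 v (rvX2 t) (rvY t).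
Let gA2 (t : omega) (s : letters) : R :=
  let: (_, _, _, x2, _) := s in dA2 (rvV t) x2 (rvY t).
Let gA3 (t : omega) (s : letters) : R :=
  let: (_, v, _, x2, _) := s in dA3 v x2 (rvY t).
Let gC1 (t : omega) (s : letters) : R :=
  let: (_, v, _, _, _) := s in dC1 v (rvX1 t).
(** Encoder 2 observes [x1] without noise: a rival [m'] matters only if its word coincides with the
    true one, and the score is evaluated at the true word. *)
Let gC2 (t : omega) (s : letters) : R :=
  let: (_, _, x1, _, _) := s in
  (rvX1 t == x1)%:R * dC2 (rvU t) (rvV t) (rvX1 t).
Let gB1 (t : omega) (s : letters) : R :=
  let: (_, v, _, _, _) := s in dB1 v (rvYc t).
Let gB2 (t : omega) (s : letters) : R :=
  let: (_, _, x1, _, xc) := s in dB2 (rvV t) x1 xc (rvYc t).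
Let gB3 (t : omega) (s : letters) : R :=
  let: (_, _, _, _, xc) := s in dB3 (rvU t) (rvV t) (rvX1 t) xc (rvYc t).

(** Each sum runs only over the coordinates that its score reads: a wrong [m1] for Encoder 2 is
    counted without [m'], a wrong [mb] without [k] and [mc]. This keeps the corresponding conditions
    down to the rates of [m1] and of [mb]. *)
Let rivals (i : index) (p : cbook * Y * Y) : R :=
  let: (k, m1, m', m2, mc) := i in
  let t := observed i p in let cw := codeword p.1.1 in
  (\sum_(n | n != m1) gA1 t (cw (k, n, m', m2, mc)) +
   \sum_(n | n != m2) gA2 t (cw (k, m1, m', n, mc)) +
   \sum_(n : M1 * M2 | (n.1 != m1) && (n.2 != m2))
      gA3 t (cw (k, n.1, m', n.2, mc))) +
  (\sum_(n | n != m1) gC1 t (cw (k, n, m', m2, mc)) +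
   \sum_(n | n != m') gC2 t (cw (k, m1, n, m2, mc))) +
  (\sum_(n | n != m1.2) gB1 t (cw (k, (m1.1, n), m', m2, mc)) +
   \sum_(n : K * Mc | n.1 != k) gB2 t (cw (n.1, m1, m', m2, n.2)) +
   \sum_(n | n != mc) gB3 t (cw (k, m1, m', m2, n))).

Definition rivals_bound : R :=
  (#|{: M1}|.-1%:R * cA1 + #|M2|.-1%:R * cA2 + (#|{: M1}| * #|M2|)%N.-1%:R * cA3) +
  (#|{: M1}|.-1%:R * cC1 + #|Kb|.-1%:R * cC2) +
  (#|Mb|.-1%:R * cB1 + (#|{: K}| * #|Mc|)%N.-1%:R * cB2 + #|Mc|.-1%:R * cB3).

Lemma expect_rivals_le (i : index) :
  \sum_p ensemble_law PU PV PX1 PX2 PX2c W i p * rivals i p <= rivals_bound.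
Proof.
case: i => [[[[k m1] m'] m2] mc]; rewrite /rivals /=.
set i := (k, m1, m', m2, mc).
have card1 (T : finType) (x : T) (c S : R) : S <= #|[pred y | y != x]|%:R * c ->
    S <= #|T|.-1%:R * c.
  by move=> /le_trans; apply; rewrite -(cardC1 x).
do ![under eq_bigr => p _ do rewrite mulrDr].
do ![rewrite big_split /=].
rewrite /rivals_bound; apply: lerD; first apply: lerD;
  [apply: lerD; first apply: lerD|apply: lerD|apply: lerD; first apply: lerD].
- apply: (card1 _ m1); apply: (expect_rivals hU hV hX1 hX2 hX2c
    (j := fun n => (k, n, m', m2, mc)) (g := gA1)) => n nm.
  apply: le_trans hA1; rewrite le_eqVlt; apply/orP; left; apply/eqP.
  apply: eq_bigr => -[[[[[[u v] x1] x2] xc] y] yc] _; congr (_ * _).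
  rewrite /i /= !xpair_eqE !eqxx eq_sym (negbTE nm) /tilt /=.
  by apply: eq_bigr => v' _; rewrite -big_distrl /= (hX1 _).2 mul1r.
- apply: (card1 _ m2); apply: (expect_rivals hU hV hX1 hX2 hX2c
    (j := fun n => (k, m1, m', n, mc)) (g := gA2)) => n nm.
  apply: le_trans hA2; rewrite le_eqVlt; apply/orP; left; apply/eqP.
  apply: eq_bigr => -[[[[[[u v] x1] x2] xc] y] yc] _; congr (_ * _).
  by rewrite /i /= !xpair_eqE !eqxx eq_sym (negbTE nm) /tilt /=.
(* The count is coarsened to all pairs other than the true one: it then has the form [_.-1], which
   vanishes when there is a single message. *)
- apply: (@le_trans _ _ (#|[pred q : M1 * M2 | (q.1 != m1) && (q.2 != m2)]|%:R * cA3)).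
    apply: (expect_rivals hU hV hX1 hX2 hX2c
      (j := fun n : M1 * M2 => (k, n.1, m', n.2, mc)) (g := gA3)) => -[n n'] /andP[/= nm nm'].
    apply: le_trans hA3; rewrite le_eqVlt; apply/orP; left; apply/eqP.
    apply: eq_bigr => -[[[[[[u v] x1] x2] xc] y] yc] _; congr (_ * _).
    rewrite /i /= !xpair_eqE !eqxx [m1 == n]eq_sym (negbTE nm).
    rewrite [m2 == n']eq_sym (negbTE nm') /tilt /=.
    by apply: eq_bigr => v' _; rewrite -big_distrl /= (hX1 _).2 mul1r.
  rewrite ler_wpM2r // ler_nat -card_prod -(cardC1 (m1, m2)); apply: subset_leq_card.
  by apply/fintype.subsetP => -[n n'] /andP[/= /negbTE nm _]; rewrite !inE xpair_eqE nm.
- apply: (card1 _ m1); apply: (expect_rivals hU hV hX1 hX2 hX2c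
    (j := fun n => (k, n, m', m2, mc)) (g := gC1)) => n nm.
  apply: le_trans hC1; rewrite le_eqVlt; apply/orP; left; apply/eqP.
  apply: eq_bigr => -[[[[[[u v] x1] x2] xc] y] yc] _; congr (_ * _).
  rewrite /i /= !xpair_eqE !eqxx eq_sym (negbTE nm) /tilt /=.
  by apply: eq_bigr => v' _; rewrite -big_distrl /= (hX1 _).2 mul1r.
- apply: (card1 _ m'); apply: (expect_rivals hU hV hX1 hX2 hX2c
    (j := fun n => (k, m1, n, m2, mc)) (g := gC2)) => n nm.
  apply: le_trans hC2; rewrite le_eqVlt; apply/orP; left; apply/eqP.
  apply: eq_bigr => -[[[[[[u v] x1] x2] xc] y] yc] _; congr (_ * _).
  rewrite /i /= !xpair_eqE !eqxx eq_sym (negbTE nm) /tilt /=.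
  under eq_bigr => x1' _ do rewrite mulrCA.
  by rewrite sum_delta.
- apply: (card1 _ m1.2); apply: (expect_rivals hU hV hX1 hX2 hX2c
    (j := fun n => (k, (m1.1, n), m', m2, mc)) (g := gB1)) => n nm.
  apply: le_trans hB1; rewrite le_eqVlt; apply/orP; left; apply/eqP.
  apply: eq_bigr => -[[[[[[u v] x1] x2] xc] y] yc] _; congr (_ * _).
  rewrite /i [m1 in LHS]surjective_pairing /= !xpair_eqE !eqxx eq_sym (negbTE nm) /tilt /=.
  by apply: eq_bigr => v' _; rewrite -big_distrl /= (hX1 _).2 mul1r.
- apply: (@le_trans _ _ (#|[pred q : K * Mc | q.1 != k]|%:R * cB2)).
    apply: (expect_rivals hU hV hX1 hX2 hX2c
      (j := fun n : K * Mc => (n.1, m1, m', m2, n.2)) (g := gB2)) => -[n n'] /= nk.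
    apply: le_trans hB2; rewrite le_eqVlt; apply/orP; left; apply/eqP.
    apply: eq_bigr => -[[[[[[u v] x1] x2] xc] y] yc] _; congr (_ * _).
    by rewrite /i /= !xpair_eqE !eqxx eq_sym (negbTE nk) /tilt /=.
  rewrite ler_wpM2r // ler_nat -card_prod -(cardC1 (k, mc)); apply: subset_leq_card.
  by apply/fintype.subsetP => -[n n'] /= /negbTE nm; rewrite !inE xpair_eqE nm.
- apply: (card1 _ mc); apply: (expect_rivals hU hV hX1 hX2 hX2c
    (j := fun n => (k, m1, m', m2, n)) (g := gB3)) => n nm.
  apply: le_trans hB3; rewrite le_eqVlt; apply/orP; left; apply/eqP.
  apply: eq_bigr => -[[[[[[u v] x1] x2] xc] y] yc] _; congr (_ * _).
  by rewrite /i /= !xpair_eqE !eqxx eq_sym (negbTE nm) /tilt /=.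
Qed.

(** * Threshold decoders and their error events *)

Section Decoders.
Variables (u : {ffun K -> U}) (v : {ffun M1 -> V}) (x1 : {ffun K * M1 * Kb -> X1})
  (x2 : {ffun M2 -> X2}) (xc : {ffun K * Mc -> X2}) (ka0 : Ka) (kb0 : Kb)
  (mb0 : Mb) (m20 : M2) (mc0 : Mc).

Let decA (y : Y) : M1 * M2 :=
  pickd ((ka0, mb0), m20) (fun q => testA (v q.1) (x2 q.2) y).
Let decC (k : K) (x : X1) : M1 * Kb :=
  pickd ((ka0, mb0), kb0)
    (fun q => (x == x1 (k, q.1, q.2)) && testC (u k) (v q.1) x).
Let decB (y : Y) (k' : K) : Mb * K * Mc :=
  pickd (mb0, (ka0, kb0), mc0)
    (fun q => let m := (k'.1, q.1.1) in
       testB (u q.1.2) (v m) (x1 (q.1.2, m, k'.2)) (xc (q.1.2, q.2)) y).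

(** Holds for each codebook and each pair of outputs. A wrong candidate that passes is charged to
    one sum: for A according to which of [m1], [m2] is wrong, for C to [m1] before [m'], for B to
    [mb] before [k] before [mc]. *)
Lemma decoding_errors_le (i : index) (y yc : Y) :
  let: (k, m1, m', m2, mc) := i in
  (((decC k (x1 (k, m1, m'))).1.1, (decC k (x1 (k, m1, m'))).2) != (m1.1, m'))%:R
  + (decA y != (m1, m2))%:R + (decB yc (m1.1, m') != (m1.2, k, mc))%:R <=
  atypical (observed i ((u, v, x1, x2, xc), y, yc)) +
  rivals i ((u, v, x1, x2, xc), y, yc) :> R.
Proof.
case: i => [[[[k [ka mb]] m'] m2] mc] /=.
have ltP (d : R) : (d < 1)%R%:R = (~~ (1 <= d))%:R :> R by rewrite ltNge.
have sum0 (T : finType) (D : pred T) (F : T -> R) : (forall t, 0 <= F t) ->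
  0 <= \sum_(t | D t) F t by move=> F0; apply: sumr_ge0.
rewrite !ltP.
set rA1 := \sum_(n | n != (ka, mb)) dA1 _ _ _.
set rA2 := \sum_(n | n != m2) _; set rA3 := \sum_(n | (n.1 != _) && _) _.
set rC1 := \sum_(n | n != (ka, mb)) dC1 _ _; set rC2 := \sum_(n | n != m') _.
set rB1 := \sum_(n | n != mb) _; set rB2 := \sum_(n | n.1 != k) _.
set rB3 := \sum_(n | n != mc) _.
have rA1_ge0 : 0 <= rA1 by exact: sum0.
have rA2_ge0 : 0 <= rA2 by exact: sum0.
have rA3_ge0 : 0 <= rA3 by exact: sum0.
have rC1_ge0 : 0 <= rC1 by exact: sum0.
have rC2_ge0 : 0 <= rC2 by apply: sum0 => n; rewrite mulr_ge0.
have rB1_ge0 : 0 <= rB1 by exact: sum0.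
have rB2_ge0 : 0 <= rB2 by exact: sum0.
have rB3_ge0 : 0 <= rB3 by exact: sum0.
set a1 := dA1 _ _ _; set a2 := dA2 _ _ _; set a3 := dA3 _ _ _.
set c1 := dC1 _ _; set c2 := dC2 _ _ _.
set b1 := dB1 _ _; set b2 := dB2 _ _ _ _; set b3 := dB3 _ _ _ _ _.
have errA : (decA y != (ka, mb, m2))%:R <=
    ((~~ (1 <= a1))%:R + (~~ (1 <= a2))%:R + (~~ (1 <= a3))%:R) + (rA1 + rA2 + rA3).
  apply: pickd_error; rewrite ?addr_ge0 //.
    by rewrite /testA -/a1 -/a2 -/a3;
      case: (1 <= a1); case: (1 <= a2); case: (1 <= a3) => //= _; lra.
  case=> n n' ne /and3P[/= t1 t2 t3].
  case: (eqVneq n (ka, mb)) => [en|nn]; last case: (eqVneq n' m2) => [en'|nn'].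
  - move: ne; rewrite en xpair_eqE eqxx /= => nn'.
    suff : 1 <= rA2 by lra.
    by apply: (le1_sum (t := n')) => //; rewrite -en.
  - suff : 1 <= rA1 by lra.
    by apply: (le1_sum (t := n)) => //; rewrite -en'.
  - suff : 1 <= rA3 by lra.
    by apply: (le1_sum (t := (n, n'))) => //=; rewrite nn nn'.
have errC : (((decC k (x1 (k, (ka, mb), m'))).1.1,
    (decC k (x1 (k, (ka, mb), m'))).2) != (ka, m'))%:R <=
    ((~~ (1 <= c1))%:R + (~~ (1 <= c2))%:R) + (rC1 + rC2).
  (* Encoder 2 decodes the whole of [m1], although only its [Ka]-part enters the next state. *)
  apply: (@le_trans _ _ (decC k (x1 (k, (ka, mb), m')) != ((ka, mb), m'))%:R).
    rewrite ler_nat; case: (decC _ _) => -[n l] n' /=; rewrite !xpair_eqE.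
    by case: (n == ka); case: (l == mb); case: (n' == m').
  apply: pickd_error; rewrite ?addr_ge0 //.
    rewrite /testC /= eqxx -/c1 -/c2.
    by case: (1 <= c1); case: (1 <= c2) => //= _; lra.
  case=> n n' ne /andP[/= e /andP[t1 t2]].
  case: (eqVneq n (ka, mb)) => [en|nn].
    subst n; move: ne; rewrite xpair_eqE eqxx /= => nn'.
    suff : 1 <= rC2 by lra.
    apply: (le1_sum (t := n')) => [t||]; rewrite ?mulr_ge0 //.
    by rewrite e mul1r.
  suff : 1 <= rC1 by lra.
  exact: (le1_sum (t := n)).
have errB : (decB yc (ka, m') != (mb, k, mc))%:R <=
    ((~~ (1 <= b1))%:R + (~~ (1 <= b2))%:R + (~~ (1 <= b3))%:R) + (rB1 + rB2 + rB3).
  apply: pickd_error; rewrite ?addr_ge0 //.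
    by rewrite /testB /= -/b1 -/b2 -/b3;
      case: (1 <= b1); case: (1 <= b2); case: (1 <= b3) => //= _; lra.
  case=> -[n l] n' ne /and3P[/= t1 t2 t3].
  case: (eqVneq n mb) => [en|nn]; last first.
    suff : 1 <= rB1 by lra.
    exact: (le1_sum (t := n)).
  subst n; case: (eqVneq l k) => [el|nl]; last first.
    suff : 1 <= rB2 by lra.
    exact: (le1_sum (t := (l, n'))).
  subst l; move: ne; rewrite !xpair_eqE !eqxx /= => nn'.
  suff : 1 <= rB3 by lra.
  exact: (le1_sum (t := n')).
by lra.
Qed.
End Decoders.

Definition atypical_prob : R :=
  (\sum_t law t * (dA1 (rvV t) (rvX2 t) (rvY t) < 1)%R%:R +
   \sum_t law t * (dA2 (rvV t) (rvX2 t) (rvY t) < 1)%R%:R +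
   \sum_t law t * (dA3 (rvV t) (rvX2 t) (rvY t) < 1)%R%:R) +
  (\sum_t law t * (dC1 (rvV t) (rvX1 t) < 1)%R%:R +
   \sum_t law t * (dC2 (rvU t) (rvV t) (rvX1 t) < 1)%R%:R) +
  (\sum_t law t * (dB1 (rvV t) (rvYc t) < 1)%R%:R +
   \sum_t law t * (dB2 (rvV t) (rvX1 t) (rvX2c t) (rvYc t) < 1)%R%:R +
   \sum_t law t * (dB3 (rvU t) (rvV t) (rvX1 t) (rvX2c t) (rvYc t) < 1)%R%:R).

Lemma sum_outputs (x1 : X1) (x2 xc : X2) (c : R) (a b : pred Y) :
  \sum_y \sum_yc W x1 x2 y * W x1 xc yc * (c + (a y)%:R + (b yc)%:R) =
  c + \sum_(y | a y) W x1 x2 y + \sum_(y | b y) W x1 xc y.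
Proof.
transitivity (\sum_y W x1 x2 y * (c + (a y)%:R + \sum_(yc | b yc) W x1 xc yc)).
  apply: eq_bigr => y _; under eq_bigr => yc _ do rewrite -mulrA mulrDr.
  rewrite -big_distrr /= big_split /= -big_distrl /= (hW _ _).2 mul1r; congr (_ * (_ + _)).
  by rewrite [RHS]big_mkcond; apply: eq_bigr => yc _; case: (b yc); rewrite ?mulr1 ?mulr0.
under eq_bigr => y _ do rewrite mulrDr mulrDr.
rewrite !big_split /= -!big_distrl /= (hW _ _).2 !mul1r; congr (_ + _ + _).
by rewrite [RHS]big_mkcond; apply: eq_bigr => y _; case: (a y); rewrite ?mulr1 ?mulr0.
Qed.

(** Random coding: the failures of all three tasks are summed over all indices before the codebook
    is chosen. The given messages are the default outputs of the decoders when no candidate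
    passes. *)
Lemma one_shot (ka0 : Ka) (kb0 : Kb) (mb0 : Mb) (m20 : M2) (mc0 : Mc) :
  exists x1 x2 xc gA gC gB,
    \sum_i block_fail x1 x2 xc gA gC gB i <=
    #|{: index}|%:R * (atypical_prob + rivals_bound).
Proof.
pose decA (cb : cbook) (y : Y) : M1 * M2 :=
  let: (u, v, x1, x2, xc) := cb in
  pickd ((ka0, mb0), m20) (fun q => testA (v q.1) (x2 q.2) y).
pose decC (cb : cbook) (k : K) (x : X1) : K :=
  let: (u, v, x1, x2, xc) := cb in
  let q := pickd ((ka0, mb0), kb0)
    (fun q => (x == x1 (k, q.1, q.2)) && testC (u k) (v q.1) x) in
  (q.1.1, q.2).
pose decB (cb : cbook) (y : Y) (k' : K) : Mb * K * Mc :=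
  let: (u, v, x1, x2, xc) := cb in
  pickd (mb0, (ka0, kb0), mc0)
    (fun q => let m := (k'.1, q.1.1) in
       testB (u q.1.2) (v m) (x1 (q.1.2, m, k'.2)) (xc (q.1.2, q.2)) y).
pose fail (cb : cbook) i := let: (u, v, x1, x2, xc) := cb in
  block_fail x1 x2 xc (decA cb) (decC cb) (decB cb) i.
suff [cb] : exists cb, \sum_i fail cb i <=
    #|{: index}|%:R * (atypical_prob + rivals_bound).
  by case: cb => [[[[u v] x1] x2] xc] le; exists x1, x2, xc, (decA (u, v, x1, x2, xc)),
    (decC (u, v, x1, x2, xc)), (decB (u, v, x1, x2, xc)).
pose i0 : index := ((ka0, kb0), (ka0, mb0), kb0, m20, mc0).
apply: (exists_le_mean (w := codebook_law PU PV PX1 PX2 PX2c)).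
- exact: (codebook_law_ge0 hU hV hX1 hX2 hX2c).
- exact: (codebook_law_sum1 hU hV hX1 hX2 hX2c i0).
under eq_bigr => cb _ do rewrite big_distrr /=.
rewrite exchange_big /= -sum1_card natr_sum big_distrl /=; apply: ler_sum => i _.
rewrite mul1r.
have <- : \sum_t law t * atypical t = atypical_prob.
  rewrite /atypical_prob -!big_split /=; apply: eq_bigr => t _.
  by rewrite -!mulrDr; case: t => [[[[[[u v] x1] x2] xc] y] yc].
rewrite -(expect_observed W hU hV hX1 hX2 hX2c i).
apply: le_trans (lerD (lexx _) (expect_rivals_le i)).
rewrite -big_split /=; under [leRHS]eq_bigr => p _ do rewrite -mulrDr.
rewrite (sum_ensemble _ _ _ _ _ _ i (fun p => atypical (observed i p) + rivals i p)).
apply: ler_sum => cb _; apply: ler_wpM2l; first exact: (codebook_law_ge0 hU hV hX1 hX2 hX2c).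
case: cb => [[[[u v] x1] x2] xc]; rewrite /fail.
have := decoding_errors_le u v x1 x2 xc ka0 kb0 mb0 m20 mc0 i.
case: i => [[[[k m1] m'] m2] mc] le /=; rewrite -sum_outputs.
apply: ler_sum => y _; apply: ler_sum => yc _; apply: ler_wpM2l; last exact: le.
by rewrite mulr_ge0 //; [exact: (hW _ _).1|exact: (hW _ _).1].
Qed.

End OneShot.

(** * Open codes and their concatenation *)

Section OpenCodes.
Context {R : realType} {X1 X2 Y : finType}.
Variable W : X1 -> X2 -> Y -> R.
Hypothesis hW : is_mac W.

Definition left_part (A : Type) (m n : nat) (x : (m + n).-tuple A) : m.-tuple A :=
  [tuple tnth x (lshift n i) | i < m].
Definition right_part (A : Type) (m n : nat) (x : (m + n).-tuple A) : n.-tuple A :=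
  [tuple tnth x (rshift m i) | i < n].

Lemma left_part_cat (A : Type) (m n : nat) (s : m.-tuple A) (t : n.-tuple A) :
  left_part [tuple of s ++ t] = s.
Proof. by apply: eq_from_tnth => i; rewrite tnth_mktuple tnth_lshift. Qed.

Lemma right_part_cat (A : Type) (m n : nat) (s : m.-tuple A) (t : n.-tuple A) :
  right_part [tuple of s ++ t] = t.
Proof. by apply: eq_from_tnth => i; rewrite tnth_mktuple tnth_rshift. Qed.

Lemma mac_law_ge0 n (x1 : n.-tuple X1) (x2 : n.-tuple X2) y : 0 <= mac_law W x1 x2 y.
Proof. by apply: prodr_ge0 => i _; exact: (hW _ _).1. Qed.

Lemma mac_law_pmf n (x1 : n.-tuple X1) (x2 : n.-tuple X2) : is_pmf (mac_law W x1 x2).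
Proof.
split=> [y|]; first exact: mac_law_ge0.
rewrite /mac_law (sum_tuple_prod (fun i => W (tnth x1 i) (tnth x2 i))).
by apply: big1 => i _; exact: (hW _ _).2.
Qed.

Definition error_prob n (x1 : n.-tuple X1) (x2 : n.-tuple X2)
    (err : pred (n.-tuple Y)) : R :=
  \sum_(y | err y) mac_law W x1 x2 y.

Lemma error_prob_ge0 n (x1 : n.-tuple X1) (x2 : n.-tuple X2) err :
  0 <= error_prob x1 x2 err.
Proof. by apply: sumr_ge0 => y _; exact: mac_law_ge0. Qed.

Lemma error_prob_le1 n (x1 : n.-tuple X1) (x2 : n.-tuple X2) err :
  error_prob x1 x2 err <= 1.
Proof.
rewrite -(mac_law_pmf x1 x2).2 /error_prob [leRHS] (bigID err) /= lerDl.
by apply: sumr_ge0 => y _; exact: mac_law_ge0.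
Qed.

Lemma error_prob_sub n (x1 : n.-tuple X1) (x2 : n.-tuple X2) (err err' : pred (n.-tuple Y)) :
  (forall y, err y -> err' y) -> error_prob x1 x2 err <= error_prob x1 x2 err'.
Proof.
move=> sub; rewrite /error_prob big_mkcond [leRHS]big_mkcond /=.
apply: ler_sum => y _; case: ifP => [/sub -> //|_].
by case: ifP => _ //; exact: mac_law_ge0.
Qed.

(** The memoryless law factorizes over the two halves of the output; what remains is a union
    bound. *)
Lemma error_prob_cat m n (x1 : m.-tuple X1) (x2 : m.-tuple X2)
    (z1 : n.-tuple X1) (z2 : n.-tuple X2) (err : pred ((m + n).-tuple Y))
    (errl : pred (m.-tuple Y)) (errr : pred (n.-tuple Y)) :
  (forall (y : m.-tuple Y) (z : n.-tuple Y), err [tuple of y ++ z] -> errl y || errr z) ->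
  error_prob [tuple of x1 ++ z1] [tuple of x2 ++ z2] err <=
  error_prob x1 x2 errl + error_prob z1 z2 errr.
Proof.
move=> sub; rewrite /error_prob big_mkcond sum_cat_tuple.
apply: (@le_trans _ _ (\sum_y \sum_z (mac_law W x1 x2 y * mac_law W z1 z2 z *
  ((errl y)%:R + (errr z)%:R)))).
  apply: ler_sum => y _; apply: ler_sum => z _.
  have -> : mac_law W [tuple of x1 ++ z1] [tuple of x2 ++ z2] [tuple of y ++ z] =
      mac_law W x1 x2 y * mac_law W z1 z2 z.
    rewrite /mac_law big_split_ord /=; congr (_ * _).
      by apply: eq_bigr => i _; rewrite !tnth_lshift.
    by apply: eq_bigr => i _; rewrite !tnth_rshift.
  have ge0 : 0 <= mac_law W x1 x2 y * mac_law W z1 z2 z.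
    by rewrite mulr_ge0 // mac_law_ge0.
  case: ifP => [/sub|_]; last by rewrite mulr_ge0 // addr_ge0.
  by rewrite -[leLHS]mulr1 => e; apply: ler_wpM2l => //;
    case: (errl y) (errr z) e => [] [] //= _; lra.
under eq_bigr => y _ do under eq_bigr => z _ do rewrite -mulrA mulrDr.
under eq_bigr => y _ do rewrite -big_distrr /= big_split /= -big_distrl /=
  (mac_law_pmf _ _).2 mul1r mulrDr.
rewrite big_split /= -big_distrl /= (mac_law_pmf _ _).2 mul1r; apply: lerD.
  rewrite le_eqVlt [eqbRHS]big_mkcond; apply/orP; left; apply/eqP.
  by apply: eq_bigr => y _; case: (errl y); rewrite ?mulr1 ?mulr0.
rewrite le_eqVlt [eqbRHS]big_mkcond; apply/orP; left; apply/eqP.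
by apply: eq_bigr => y _; case: (errr y); rewrite ?mulr1 ?mulr0.
Qed.

(* A code between two states in [Ka * Kb]: both encoders know the initial
   state, Encoder 1 conveys the final state to Encoder 2 by cribbing; with
   cribbing the decoder recovers the initial state from the final one, and
   without cribbing it recovers the [Ka]-part of the final state. *)
Record open_code (n : nat) (Ka Kb M1 M1' M2 Mc : finType) := OpenCode {
  oenc1 : Ka * Kb -> Ka * Kb -> M1 -> M1' -> n.-tuple X1;
  oenc2 : M2 -> n.-tuple X2;
  oenc2c : Ka * Kb -> Mc -> n.-tuple X1 -> n.-tuple X2;
  ocrib : Ka * Kb -> n.-tuple X1 -> Ka * Kb;
  odec : n.-tuple Y -> M1 * M2 * Ka;
  odecc : n.-tuple Y -> Ka * Kb -> M1 * M1' * Mc * (Ka * Kb);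
  ocausal : forall k m x x' (i : 'I_n),
    (forall j : 'I_n, (j < i)%N -> tnth x j = tnth x' j) ->
    tnth (oenc2c k m x) i = tnth (oenc2c k m x') i }.

Definition open_fail n Ka Kb M1 M1' M2 Mc (c : open_code n Ka Kb M1 M1' M2 Mc)
    (s : (Ka * Kb) * (Ka * Kb) * M1 * M1' * M2 * Mc) : R :=
  let: (k, l, m1, m1', m2, mc) := s in let x := oenc1 c k l m1 m1' in
  (ocrib c k x != l)%:R +
  error_prob x (oenc2 c m2) (fun y => odec c y != (m1, m2, l.1)) +
  error_prob x (oenc2c c k mc x) (fun y => odecc c y l != (m1, m1', mc, k)).

(** The average runs over both states as well as the messages. In a concatenation the middle state
    is a uniform message, so each block is averaged exactly as here. *)
Definition has_code (n : nat) (Ka Kb : finType) (eps a b c d : R) : Prop :=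
  exists (M1 M1' M2 Mc : finType) (code : open_code n Ka Kb M1 M1' M2 Mc),
    [/\ a <= #|M1|%:R, b <= #|M1'|%:R, c <= #|M2|%:R & d <= #|Mc|%:R] /\
    \sum_s open_fail code s <=
      eps * #|{: (Ka * Kb) * (Ka * Kb) * M1 * M1' * M2 * Mc}|%:R.

(** Averaging over an extra independent component changes nothing; [C] will hold the data on which
    the failure under consideration does not depend. *)
Lemma mean_proj (A B C : finType) (f : A -> B * C) (F : B -> R) (eps : R) :
  bijective f -> \sum_b F b <= eps * #|B|%:R ->
  \sum_a F (f a).1 <= eps * #|A|%:R.
Proof.
move=> fb le; rewrite (bij_eq_card fb) card_prod natrM mulrA.
rewrite (_ : \sum_a F (f a).1 = (\sum_b F b) * #|C|%:R).
  by rewrite ler_wpM2r.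
rewrite big_distrl /=.
transitivity (\sum_(p : B * C) F p.1).
  by rewrite [RHS] (reindex f) //; exact: onW_bij.
rewrite -(pair_bigA _ (fun b _ => F b)) /=; apply: eq_bigr => b _.
by rewrite sumr_const mulr_natr.
Qed.

Section Concat.
Context {n1 n2 : nat} {Ka Kb M1 M1' M2 Mc N1 N1' N2 Nc : finType}.
Variables (c1 : open_code n1 Ka Kb M1 M1' M2 Mc)
  (c2 : open_code n2 Ka Kb N1 N1' N2 Nc).

Let enc2c (k : Ka * Kb) (m : Mc * Nc) (x : (n1 + n2).-tuple X1) :=
  [tuple of oenc2c c1 k m.1 (left_part x) ++
            oenc2c c2 (ocrib c1 k (left_part x)) m.2 (right_part x)].

Lemma concat_causal k m x x' (i : 'I_(n1 + n2)) :
  (forall j : 'I_(n1 + n2), (j < i)%N -> tnth x j = tnth x' j) ->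
  tnth (enc2c k m x) i = tnth (enc2c k m x') i.
Proof.
move=> xx'; rewrite /enc2c; case: (split_ordP i) => j ij.
  rewrite ij !tnth_lshift; apply: ocausal => l lj.
  by rewrite !tnth_mktuple; apply: xx'; rewrite ij.
(* At a position of the second block the whole first block lies in the past, so the state read from
   it may be used. *)
have -> : left_part x = left_part x'.
  apply: eq_from_tnth => l; rewrite !tnth_mktuple; apply: xx'.
  by rewrite ij /= (leq_trans (ltn_ord l)) // leq_addr.
rewrite ij !tnth_rshift; apply: ocausal => l lj.
by rewrite !tnth_mktuple; apply: xx'; rewrite ij /= ltn_add2l.
Qed.

(** The middle state becomes a message, its [Ka]-part among those decoded in both modes, its
    [Kb]-part among those decoded only with cribbing. [odecc] goes backward: the initial state found
    in the second block is passed on as the final state of the first. *)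
Definition concat_code :
    open_code (n1 + n2) Ka Kb (M1 * Ka * N1)%type (M1' * Kb * N1')%type
      (M2 * N2)%type (Mc * Nc)%type :=
  OpenCode
    (fun k l m m' => let k' := (m.1.2, m'.1.2) in
       [tuple of oenc1 c1 k k' m.1.1 m'.1.1 ++ oenc1 c2 k' l m.2 m'.2])
    (fun m => [tuple of oenc2 c1 m.1 ++ oenc2 c2 m.2])
    (fun k x => ocrib c2 (ocrib c1 k (left_part x)) (right_part x))
    (fun y => let d := odec c1 (left_part y) in let e := odec c2 (right_part y) in
       ((d.1.1, d.2, e.1.1), (d.1.2, e.1.2), e.2))
    (fun y l => let e := odecc c2 (right_part y) l in
       let d := odecc c1 (left_part y) e.2 in
       ((d.1.1.1, e.2.1, e.1.1.1), (d.1.1.2, e.2.2, e.1.1.2), (d.1.2, e.1.2), d.2))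
    concat_causal.

(** The factor 2 pays for a cribbing failure in the first block: it may spoil the final state of
    Encoder 2, and it makes the input of Encoder 2 in the second block unreliable, where the
    decoding error with cribbing is only bounded by 1. *)
Lemma open_fail_concat k l m1 ka n m1' kb n' m2 n2' mc nc :
  open_fail concat_code (k, l, (m1, ka, n), (m1', kb, n'), (m2, n2'), (mc, nc)) <=
  2 * open_fail c1 (k, (ka, kb), m1, m1', m2, mc) +
  open_fail c2 ((ka, kb), l, n, n', n2', nc).
Proof.
rewrite /open_fail /= /enc2c /= !left_part_cat !right_part_cat.
set x := oenc1 c1 _ _ _ _; set z := oenc1 c2 _ _ _ _.
set A1 := error_prob x _ _; set P1 := error_prob x _ _.
set A2 := error_prob z _ _; set P2 := error_prob z _ _.
have A1_ge0 : 0 <= A1 by exact: error_prob_ge0.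
have A2_ge0 : 0 <= A2 by exact: error_prob_ge0.
have P1_ge0 : 0 <= P1 by exact: error_prob_ge0.
have P2_ge0 : 0 <= P2 by exact: error_prob_ge0.
set A := error_prob _ _ _; set P := error_prob _ _ _.
have leA : A <= A1 + A2.
  apply: error_prob_cat => y y' /=; rewrite left_part_cat right_part_cat.
  case: (odec c1 y) (odec c2 y') => [[a b] d] [[a' b'] d'] /=.
  rewrite -negb_and; apply: contra => /andP[/eqP[-> -> ->] /eqP[-> -> ->]] //.
have P_le1 : P <= 1 by exact: error_prob_le1.
move: @P P_le1; case: (eqVneq (ocrib c1 k x) (ka, kb)) => [->|_] P P_le1 /=.
  have leP : P <= P1 + P2.
    apply: error_prob_cat => y y' /=; rewrite left_part_cat right_part_cat.
    rewrite -negb_and; apply: contra => /andP[/eqP e1 /eqP e2].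
    by rewrite e2 /= e1.
  by case: (_ != l) => /=; lra.
by case: (_ != l) => /=; case: (_ != l) => /=; lra.
Qed.

End Concat.

Lemma has_code_concat n1 n2 Ka Kb e1 e2 a b c d a' b' c' d' :
  0 <= a -> 0 <= b -> 0 <= c -> 0 <= d -> 0 <= a' -> 0 <= b' -> 0 <= c' -> 0 <= d' ->
  has_code n1 Ka Kb e1 a b c d -> has_code n2 Ka Kb e2 a' b' c' d' ->
  has_code (n1 + n2) Ka Kb (2 * e1 + e2)
    (a * #|Ka|%:R * a') (b * #|Kb|%:R * b') (c * c') (d * d').
Proof.
move=> a0 b0 c0 d0 a0' b0' c0' d0'.
move=> [M1 [M1' [M2 [Mc [c1 [[h1 h1' h2 hc] f1]]]]]].
move=> [N1 [N1' [N2 [Nc [c2 [[g1 g1' g2 gc] f2]]]]]].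
exists (M1 * Ka * N1)%type, (M1' * Kb * N1')%type, (M2 * N2)%type, (Mc * Nc)%type.
exists (concat_code c1 c2); split.
  by rewrite !card_prod !natrM; split; rewrite !ler_pM ?mulr_ge0.
pose T := ((Ka * Kb) * (Ka * Kb) * (M1 * Ka * N1) * (M1' * Kb * N1') *
  (M2 * N2) * (Mc * Nc))%type.
(* [p1] and [p2] split the data of the long code into those of one block and the rest; the middle
   state goes with the block in both cases. *)
pose p1 (s : T) :=
  let: (k, l, (m1, ka, n), (m1', kb, n'), (m2, n2), (mc, nc)) := s in
  ((k, (ka, kb), m1, m1', m2, mc), (l, n, n', n2, nc)).
pose p2 (s : T) :=
  let: (k, l, (m1, ka, n), (m1', kb, n'), (m2, n2), (mc, nc)) := s in
  (((ka, kb), l, n, n', n2, nc), (k, m1, m1', m2, mc)).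
have bp1 : bijective p1.
  exists (fun q => let: ((k, (ka, kb), m1, m1', m2, mc), (l, n, n', n2, nc)) := q in
    (k, l, (m1, ka, n), (m1', kb, n'), (m2, n2), (mc, nc))).
    by move=> [[[[[k l] [[m1 ka] n]] [[m1' kb] n']] [m2 n2']] [mc nc]].
  by move=> [[[[[[k [ka kb]] m1] m1'] m2] mc] [[[[l n] n'] n2'] nc]].
have bp2 : bijective p2.
  exists (fun q => let: (((ka, kb), l, n, n', n2, nc), (k, m1, m1', m2, mc)) := q in
    (k, l, (m1, ka, n), (m1', kb, n'), (m2, n2), (mc, nc))).
    by move=> [[[[[k l] [[m1 ka] n]] [[m1' kb] n']] [m2 n2']] [mc nc]].
  by move=> [[[[[[[ka kb] l] n] n'] n2'] nc] [[[[k m1] m1'] m2] mc]].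
have := mean_proj bp1 f1; have := mean_proj bp2 f2 => q2 q1.
apply: (@le_trans _ _ (\sum_s (2 * open_fail c1 (p1 s).1 + open_fail c2 (p2 s).1))).
  apply: ler_sum => s _.
  case: s => [[[[[k l] [[m1 ka] n]] [[m1' kb] n']] [m2 n2']] [mc nc]].
  exact: open_fail_concat.
rewrite big_split /= -big_distrr /= [leRHS]mulrDl -mulrA; apply: lerD => //.
by rewrite ler_pM2l.
Qed.

End OpenCodes.

(** * Iteration of a code, fixing its outer states, padding *)

Section CodeTransformations.
Context {R : realType} {X1 X2 Y : finType}.
Variable W : X1 -> X2 -> Y -> R.
Hypothesis hW : is_mac W.

Lemma has_code_mono n Ka Kb e e' a a' b b' c c' d d' :
  e <= e' -> a' <= a -> b' <= b -> c' <= c -> d' <= d ->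
  has_code W n Ka Kb e a b c d -> has_code W n Ka Kb e' a' b' c' d'.
Proof.
move=> ee' aa' bb' cc' dd' [M1 [M1' [M2 [Mc [code [[ha hb hc hd] err]]]]]].
exists M1, M1', M2, Mc, code; split; last by rewrite (le_trans err) // ler_wpM2r.
by split; [exact: le_trans ha|exact: le_trans hb|exact: le_trans hc|exact: le_trans hd].
Qed.

(** The new block is put in front, so that the factor 2 of the concatenation falls on it and not on
    the code already built: the error grows linearly in the number of blocks instead of
    exponentially. *)
Lemma has_code_iter n Ka Kb e a b c d (B : nat) :
  0 <= e -> 0 <= a -> 0 <= b -> 0 <= c -> 0 <= d ->
  has_code W n Ka Kb e a b c d ->
  has_code W (B.+1 * n) Ka Kb (2 * B.+1%:R * e)
    (a ^+ B.+1 * #|Ka|%:R ^+ B) (b ^+ B.+1 * #|Kb|%:R ^+ B) (c ^+ B.+1) (d ^+ B.+1).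
Proof.
move=> e0 a0 b0 c0 d0 code; elim: B => [|B IH].
  rewrite mul1n; apply: has_code_mono code; rewrite ?expr0 ?expr1 ?mulr1 //.
  by rewrite mulr_natl mulr2n lerDl.
rewrite mulSn; apply: has_code_mono (has_code_concat hW _ _ _ _ _ _ _ _ code IH);
  rewrite ?mulr_ge0 ?exprn_ge0 //.
- by rewrite -[B.+2]add1n natrD; lra.
- by rewrite le_eqVlt !exprS; apply/orP; left; apply/eqP; ring.
- by rewrite le_eqVlt !exprS; apply/orP; left; apply/eqP; ring.
Qed.

(** Some pair of outer states is at least as good as the average. Once it is fixed the state is
    trivial, and Encoder 2 can no longer miss it. *)
Lemma has_code_close n (Ka Kb : finType) e a b c d :
  (0 < #|Ka|)%N -> (0 < #|Kb|)%N ->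
  has_code W n Ka Kb e a b c d -> has_code W n unit unit e a b c d.
Proof.
move=> Ka0 Kb0 [M1 [M1' [M2 [Mc [code [h err]]]]]].
pose K := ((Ka * Kb) * (Ka * Kb))%type.
pose M := (M1 * M1' * M2 * Mc)%type.
pose F (q : K) (r : M) : R := let: (k, l) := q in let: (m1, m1', m2, mc) := r in
  open_fail W code (k, l, m1, m1', m2, mc).
have K0 : (0 < #|{: K}|)%N by rewrite !card_prod !muln_gt0 Ka0 Kb0.
have K0' : #|{: K}|%:R != 0 :> R by rewrite pnatr_eq0 -lt0n.
have [q hq] : exists q, \sum_r F q r <= e * #|{: M}|%:R.
  apply: (exists_le_mean (w := fun=> (#|{: K}|%:R)^-1)) => [t||].
  - by rewrite invr_ge0.
  - by rewrite sumr_const -[_ *+ _]mulr_natr mulVf.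
  rewrite -big_distrr /= mulrC ler_pdivrMr ?ltr0n //.
  rewrite -mulrA -natrM -card_prod pair_bigA /=.
  pose f (s : M * K) := let: ((m1, m1', m2, mc), (k, l)) := s in
    (k, l, m1, m1', m2, mc).
  have bf : bijective f.
    exists (fun s => let: (k, l, m1, m1', m2, mc) := s in ((m1, m1', m2, mc), (k, l))).
      by move=> [[[[m1 m1'] m2] mc] [k l]].
    by move=> [[[[[k l] m1] m1'] m2] mc].
  rewrite (bij_eq_card bf); apply: le_trans err; rewrite le_eqVlt; apply/orP; left.
  apply/eqP; rewrite (reindex f) /=; last exact: onW_bij.
  rewrite -(pair_bigA _ F) exchange_big pair_bigA /=.
  by apply: eq_bigr => -[[[[m1 m1'] m2] mc] [k l]].
case: q hq => k l hq.
exists M1, M1', M2, Mc.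
exists (OpenCode (Ka := unit) (Kb := unit)
  (oenc2c := fun _ => oenc2c code k) (fun _ _ => oenc1 code k l) (oenc2 code)
  (fun _ _ => (tt, tt))
  (fun y => ((odec code y).1, tt))
  (fun y _ => ((odecc code y l).1, (tt, tt)))
  (fun _ => ocausal code k)); split=> //.
pose f (s : (unit * unit) * (unit * unit) * M1 * M1' * M2 * Mc) : M * unit :=
  let: (_, m1, m1', m2, mc) := s in ((m1, m1', m2, mc), tt).
have bf : bijective f.
  exists (fun s => let: ((m1, m1', m2, mc), _) := s in
    (((tt, tt), (tt, tt)), m1, m1', m2, mc)).
    by move=> [[[[[[[] []] [[] []]] m1] m1'] m2] mc].
  by move=> [[[[m1 m1'] m2] mc] []].
apply: le_trans (mean_proj bf hq); apply: ler_sum.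
move=> [[[[[[[] []] [[] []]] m1] m1'] m2] mc] _.
rewrite /open_fail /F /= add0r -addrA ler_wpDl //; apply: lerD.
  by apply: error_prob_sub => // y; apply: contra => /eqP ->.
by apply: error_prob_sub => // y; apply: contra => /eqP ->.
Qed.

(** Padding, to complete a multiple of the block length to an arbitrary length. *)
Lemma has_code_trivial n (x0 : X1) (z0 : X2) : has_code W n unit unit 0 1 1 1 1.
Proof.
exists unit, unit, unit, unit.
exists (OpenCode (Y := Y) (Ka := unit) (Kb := unit) (M1 := unit) (M1' := unit)
  (M2 := unit) (Mc := unit) (oenc2c := fun _ _ _ => [tuple z0 | _ < n])
  (fun _ _ _ _ => [tuple x0 | _ < n])
  (fun _ => [tuple z0 | _ < n])
  (fun _ _ => (tt, tt)) (fun y => (tt, tt, tt)) (fun y _ => (tt, tt, tt, (tt, tt)))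
  (fun _ _ _ _ _ _ => erefl)); split; first by rewrite card_unit.
rewrite mul0r big1 // => -[[[[[[[] []] [[] []]] []] []] []] []] _.
by rewrite /open_fail /= /error_prob !big_pred0 ?addr0.
Qed.

End CodeTransformations.

(** * Rates of open codes *)

Section MacCodes.
Context {R : realType} {X1 X2 Y : finType}.
Variable W : X1 -> X2 -> Y -> R.
Hypothesis hW : is_mac W.

Lemma sum_enum_val (M : finType) (F : M -> R) :
  \sum_(i < #|M|) F (enum_val i) = \sum_m F m.
Proof. by rewrite -big_enum_val. Qed.

Section OfOpen.
Context {n : nat} {M1 M1' M2 Mc : finType}.
Variables (code : @open_code X1 X2 Y n unit unit M1 M1' M2 Mc) (x0 : X1).

(** An open code expects the whole word of Encoder 1; the past is extended by [x0], and by [ocausal]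
    the choice of the extension has no effect. *)
Definition mac_of_open : @mac_code X1 X2 Y n #|M1| #|M1'| #|M2| #|Mc| :=
  MacCode (fun i j => oenc1 code (tt, tt) (tt, tt) (enum_val i) (enum_val j))
    (fun i => oenc2 code (enum_val i))
    (fun i m (p : i.-tuple X1) =>
       tnth (oenc2c code (tt, tt) (enum_val m) [tuple nth x0 p j | j < n]) i)
    (fun y => let d := odec code y in (enum_rank d.1.1, enum_rank d.1.2))
    (fun y => let d := odecc code y (tt, tt) in
       (enum_rank d.1.1.1, enum_rank d.1.1.2, enum_rank d.1.2)).

Lemma crib_input_mac_of_open m x :
  crib_input mac_of_open m x = oenc2c code (tt, tt) (enum_val m) x.
Proof.
apply: eq_from_tnth => i; rewrite tnth_mktuple /=; apply: ocausal => j ji.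
rewrite tnth_mktuple; have := tnth_nth x0 (past x i) (Ordinal ji) => /= <-.
rewrite tnth_mktuple.
by congr (tnth x _); exact: val_inj.
Qed.

Lemma errors_mac_of_open (e : R) :
  (0 < #|M1|)%N -> (0 < #|M1'|)%N -> (0 < #|M2|)%N -> (0 < #|Mc|)%N ->
  \sum_s open_fail W code s <=
    e * #|{: (unit * unit) * (unit * unit) * M1 * M1' * M2 * Mc}|%:R ->
  error_absent W mac_of_open <= e /\ error_present W mac_of_open <= e.
Proof.
move=> M10 M1'0 M20 Mc0.
have -> : \sum_s open_fail W code s = \sum_m1 \sum_m1' \sum_m2 \sum_mc
    open_fail W code ((tt, tt), (tt, tt), m1, m1', m2, mc).
  rewrite !pair_bigA /=.
  pose f (s : M1 * M1' * M2 * Mc) := let: (m1, m1', m2, mc) := s in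
    (((tt, tt), (tt, tt)), m1, m1', m2, mc).
  rewrite (reindex f) /=; first by apply: eq_bigr => -[[[m1 m1'] m2] mc].
  apply: onW_bij; exists (fun s : (unit * unit) * (unit * unit) * M1 * M1' * M2 * Mc =>
    let: (_, m1, m1', m2, mc) := s in (m1, m1', m2, mc)).
    by move=> [[[m1 m1'] m2] mc].
  by move=> [[[[[[[] []] [[] []]] m1] m1'] m2] mc].
rewrite !card_prod card_unit !mul1n !natrM => le.
have N0 (a b c : nat) : (0 < a)%N -> (0 < b)%N -> (0 < c)%N -> 0 < (a * b * c)%:R :> R.
  by move=> a0 b0 c0; rewrite ltr0n !muln_gt0 a0 b0.
have Mc0' : 0 < #|Mc|%:R :> R by rewrite ltr0n.
have M20' : 0 < #|M2|%:R :> R by rewrite ltr0n.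
split.
  rewrite /error_absent ler_pdivrMr; last exact: N0.
  (* The error without cribbing does not depend on [mc]; multiplying by the number of its values
     makes it comparable with the full sum. Below, [m2] plays this part for the error with
     cribbing. *)
  rewrite -(ler_pM2r Mc0') !natrM -[leRHS]mulrA; apply: le_trans le.
  rewrite -[leRHS]sum_enum_val big_distrl /=; apply: ler_sum => i _.
  rewrite -[leRHS]sum_enum_val big_distrl /=; apply: ler_sum => i' _.
  rewrite -[leRHS]sum_enum_val big_distrl /=; apply: ler_sum => j _.
  rewrite mulr_natr -sumr_const; apply: ler_sum => mc _.
  rewrite -[leLHS]addr0; apply: lerD; last exact: error_prob_ge0.
  rewrite -[leLHS]add0r; apply: lerD => //.
  apply: (error_prob_sub hW) => y; apply: contra => /eqP -> /=.
  by rewrite !enum_valK.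
rewrite /error_present ler_pdivrMr; last exact: N0.
rewrite -(ler_pM2r M20') !natrM -[leRHS]mulrA [X in e * X]mulrAC.
apply: le_trans le.
rewrite -[leRHS]sum_enum_val big_distrl /=; apply: ler_sum => i _.
rewrite -[leRHS]sum_enum_val big_distrl /=; apply: ler_sum => i' _.
rewrite [leRHS]exchange_big -[leRHS]sum_enum_val big_distrl /=; apply: ler_sum => j _.
rewrite mulr_natr -sumr_const; apply: ler_sum => m2 _.
rewrite -[leLHS]add0r; apply: lerD; first by rewrite addr_ge0 // error_prob_ge0.
under eq_bigr do rewrite crib_input_mac_of_open.
apply: (error_prob_sub hW) => y; apply: contra => /eqP -> /=.
by rewrite !enum_valK.
Qed.

End OfOpen.

Local Notation rates := (R^o * R^o * R^o * R^o)%type.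

(** Achievability in a form stable under concatenation, hence convex. The letter of [X1] is the one
    needed by [mac_of_open]. *)
Definition coded_rates (r : rates) : Prop :=
  let: (R1, R1', R2, R2c) := r in
  [/\ inhabited X1, nonneg_rates r &
  forall eps gamma : R, 0 < eps -> 0 < gamma -> \forall n \near \oo,
    has_code W n unit unit eps (expR (n%:R * (R1 - gamma)))
      (expR (n%:R * (R1' - gamma))) (expR (n%:R * (R2 - gamma)))
      (expR (n%:R * (R2c - gamma)))].

Lemma coded_rates_achievable (r : rates) : coded_rates r -> achievable W r.
Proof.
case: r => [[[R1 R1'] R2] R2c] [[x0] r0 codes]; split=> // eps gamma eps0 gamma0.
near=> n.
have [M1 [M1' [M2 [Mc [code [[h1 h1' h2 hc] err]]]]]] : has_code W n unit unit eps
    (expR (n%:R * (R1 - gamma))) (expR (n%:R * (R1' - gamma)))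
    (expR (n%:R * (R2 - gamma))) (expR (n%:R * (R2c - gamma))).
  by near: n; exact: codes.
have pos (x : R) (m : nat) : expR x <= m%:R -> (0 < m)%N.
  by move=> le; rewrite -(ltr_nat R) (lt_le_trans _ le) // expR_gt0.
exists #|M1|, #|M1'|, #|M2|, #|Mc|; split.
- by split; [exact: pos h1|exact: pos h1'|exact: pos h2|exact: pos hc].
- by [].
- exists (mac_of_open code x0); apply: errors_mac_of_open err.
  + exact: pos h1. + exact: pos h1'. + exact: pos h2. + exact: pos hc.
Unshelve. all: by end_near. Qed.

End MacCodes.

Lemma near_ge_natr (R : realType) (x : R) : \forall n \near \oo, x <= n%:R.
Proof.
exists (Num.truncn x).+1 => // n /= le; apply/ltW.
by rewrite (lt_le_trans (truncnS_gt x)) // ler_nat.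
Qed.

(** * Time sharing and padding *)

Section CodedRates.
Context {R : realType} {X1 X2 Y : finType}.
Variable W : X1 -> X2 -> Y -> R.
Hypothesis hW : is_mac W.
Local Notation rates := (R^o * R^o * R^o * R^o)%type.

Lemma coded_rates_convex : convex_set [set r : rates | coded_rates W r].
Proof.
apply/convex_setW => -[[[R1 R1'] R2] R2c] [[[S1 S1'] S2] S2c].
rewrite !inE => -[hx /= [R1_ge0 R1'_ge0 R2_ge0 R2c_ge0] codeR].
move=> [_ /= [S1_ge0 S1'_ge0 S2_ge0 S2c_ge0] codeS] lam lam0 lam1.
rewrite inE.
change (coded_rates W (lam%:num * R1 + (1 - lam%:num) * S1,
  lam%:num * R1' + (1 - lam%:num) * S1', lam%:num * R2 + (1 - lam%:num) * S2,
  lam%:num * R2c + (1 - lam%:num) * S2c)).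
move: (lam%:num) lam0 lam1 => l l0 l1 {lam}.
have l1' : 0 < 1 - l by rewrite subr_gt0.
split=> //.
  by split; apply: addr_ge0; apply: mulr_ge0 => //; exact: ltW.
move=> eps gamma eps0 gamma0.
(* Concatenation counts the error of the first code twice. *)
have eps3 : 0 < eps / 3 by rewrite divr_gt0.
have gamma2 : 0 < gamma / 2 by rewrite divr_gt0.
have [nR _ {}codeR] := codeR _ _ eps3 gamma2.
have [nS _ {}codeS] := codeS _ _ eps3 gamma2.
near=> n.
pose n1 := Num.truncn (l * n%:R).
have ln0 : 0 <= l * n%:R by rewrite mulr_ge0 // ltW.
have [n1_le n1_ge] := andP (truncn_itv ln0); rewrite -/n1 in n1_le n1_ge.
have n1n : (n1 <= n)%N.
  by rewrite -(ler_nat R) (le_trans n1_le) // ler_piMl // ltW.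
have n2E : (n - n1)%N%:R = n%:R - n1%:R :> R by rewrite natrB.
have n1_gt : l * n%:R < n1%:R + 1 by move: n1_ge; rewrite -natr1.
have n1R : (nR <= n1)%N.
  have : (nR%:R + 1) / l <= n%:R by near: n; exact: near_ge_natr.
  rewrite ler_pdivrMr // mulrC => h; rewrite -(ler_nat R); lra.
have n2S : (nS <= n - n1)%N.
  have : nS%:R / (1 - l) <= n%:R by near: n; exact: near_ge_natr.
  rewrite ler_pdivrMr // mulrBr mulr1 [_ * l]mulrC => h; rewrite -(ler_nat R) n2E; lra.
(* Rounding [n1] down costs the first code less than one letter, that is at most [r] in the
   exponent, and the second code only gains; half of [gamma] absorbs this loss. *)
have rate (r s : R) : 0 <= r -> 0 <= s -> r / (gamma / 2) <= n%:R ->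
  expR (n%:R * (l * r + (1 - l) * s - gamma)) <=
  expR (n1%:R * (r - gamma / 2)) * expR ((n - n1)%N%:R * (s - gamma / 2)).
  move=> r0 s0; rewrite ler_pdivrMr // => h; rewrite -expRD ler_expR n2E.
  have h1 : l * n%:R * r <= (n1%:R + 1) * r by rewrite ler_wpM2r // ltW.
  have h2 : n1%:R * s <= l * n%:R * s by rewrite ler_wpM2r.
  lra.
have := has_code_concat hW _ _ _ _ _ _ _ _ (codeR n1 n1R) (codeS _ n2S).
rewrite subnKC // => code; apply: has_code_mono (code _ _ _ _ _ _ _ _);
  rewrite ?expR_ge0 ?card_unit ?mulr1 //.
- lra.
- by apply: rate => //; near: n; exact: near_ge_natr.
- by apply: rate => //; near: n; exact: near_ge_natr.
- by apply: rate => //; near: n; exact: near_ge_natr.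
- by apply: rate => //; near: n; exact: near_ge_natr.
Unshelve. all: by end_near. Qed.

(** Lengths that are not multiples of [B] are padded. [B] may depend on [eps] and [gamma] because it
    is fixed before the length grows. *)
Lemma coded_rates_of_blocks (x0 : X1) (z0 : X2) (R1 R1' R2 R2c : R) :
  nonneg_rates (R1, R1', R2, R2c) ->
  (forall eps gamma : R, 0 < eps -> 0 < gamma ->
     exists2 B : nat, (0 < B)%N & \forall N \near \oo,
     has_code W (B * N) unit unit eps (expR ((B * N)%N%:R * (R1 - gamma)))
      (expR ((B * N)%N%:R * (R1' - gamma))) (expR ((B * N)%N%:R * (R2 - gamma)))
      (expR ((B * N)%N%:R * (R2c - gamma)))) ->
  coded_rates W (R1, R1', R2, R2c).
Proof.
move=> [R1_ge0 R1'_ge0 R2_ge0 R2c_ge0] blocks; split=> // eps gamma eps0 gamma0.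
have eps2 : 0 < eps / 2 by rewrite divr_gt0.
have gamma2 : 0 < gamma / 2 by rewrite divr_gt0.
have [B B0 [N0 _ codes]] := blocks _ _ eps2 gamma2.
near=> n.
have N0n : (N0 <= n %/ B)%N.
  by rewrite leq_divRL //; near: n; exact: nbhs_infty_ge.
have nE : n = (B * (n %/ B) + n %% B)%N by rewrite mulnC -divn_eq.
have code := has_code_concat hW _ _ _ _ _ _ _ _ (codes _ N0n)
  (has_code_trivial W (n %% B) x0 z0).
(* The padding has fewer than [B] letters, hence costs at most [B * r] in the exponent. *)
have rate (r : R) : 0 <= r -> B%:R * r / (gamma / 2) <= n%:R ->
  expR (n%:R * (r - gamma)) <= expR ((B * (n %/ B))%N%:R * (r - gamma / 2)).
  move=> r0; rewrite ler_pdivrMr // => h; rewrite ler_expR.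
  have /(congr1 (fun k => k%:R : R)) := nE; rewrite natrD => {}nE.
  have mB : (n %% B)%:R <= B%:R :> R by rewrite ler_nat ltnW // ltn_mod.
  have m0 : 0 <= (n %% B)%:R :> R by [].
  have h1 := ler_wpM2r r0 mB.
  have h2 := mulr_ge0 m0 (ltW gamma2).
  move: nE h h1 h2; set q := (B * _)%N%:R; set m := (n %% B)%:R => -> h h1 h2.
  by lra.
rewrite {1}nE; apply: has_code_mono (code _ _ _ _ _ _ _ _);
  rewrite ?expR_ge0 ?card_unit ?mulr1 //.
- lra.
- by apply: rate => //; near: n; exact: near_ge_natr.
- by apply: rate => //; near: n; exact: near_ge_natr.
- by apply: rate => //; near: n; exact: near_ge_natr.
- by apply: rate => //; near: n; exact: near_ge_natr.
Unshelve. all: by end_near. Qed.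

End CodedRates.

(** * Information densities *)

Section Densities.
Context {R : realType} {T : finType} (P : T -> R).
Hypothesis P_ge0 : forall t, 0 <= P t.

Lemma prob_ge0 (A : finType) (X : T -> A) a : 0 <= prob P X a.
Proof. by apply: sumr_ge0 => t _; exact: P_ge0. Qed.

Lemma prob_gt0 (A : finType) (X : T -> A) t : 0 < P t -> 0 < prob P X (X t).
Proof.
move=> Pt; rewrite /prob (bigD1 t) //= ltr_wpDr //.
by apply: sumr_ge0 => s _; exact: P_ge0.
Qed.

Lemma sum_prob (A : finType) (X : T -> A) (G : A -> R) :
  \sum_a prob P X a * G a = \sum_t P t * G (X t).
Proof.
under eq_bigr => a _ do rewrite /prob big_distrl /= big_mkcond /=.
rewrite exchange_big /=; apply: eq_bigr => t _.
rewrite (bigD1 (X t)) //= eqxx big1 ?addr0 // => a.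
by rewrite eq_sym => /negbTE ->.
Qed.

Lemma sum_prob_pair (A B : finType) (X : T -> A) (Y : T -> B) (G : A -> B -> R) :
  \sum_a \sum_b prob P (rvpair X Y) (a, b) * G a b = \sum_t P t * G (X t) (Y t).
Proof.
rewrite pair_bigA /= -(sum_prob (rvpair X Y) (fun q => G q.1 q.2)).
by apply: eq_bigr => -[].
Qed.

Lemma probC (A B : finType) (X : T -> A) (Y : T -> B) a b :
  prob P (rvpair X Y) (a, b) = prob P (rvpair Y X) (b, a).
Proof. by apply: eq_bigl => t; rewrite !xpair_eqE andbC. Qed.

Lemma prob_pair_le (A B : finType) (X : T -> A) (Y : T -> B) a b :
  prob P (rvpair X Y) (a, b) <= prob P Y b.
Proof.
rewrite /prob big_mkcond [leRHS]big_mkcond /=; apply: ler_sum => t _.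
by rewrite xpair_eqE; case: (X t == a); case: (Y t == b) => /=.
Qed.

Lemma sum_prob1 (A : finType) (X : T -> A) : \sum_a prob P X a = \sum_t P t.
Proof.
have := sum_prob X (fun=> 1).
under eq_bigr do rewrite mulr1.
by under [RHS]eq_bigr do rewrite mulr1.
Qed.

(** Exponential of the information density, that is the density of the joint law with respect to the
    product of its marginals. Without the logarithm it serves directly for changes of measure. *)
Definition mi_density (A B : finType) (X : T -> A) (Y : T -> B) a b : R :=
  prob P (rvpair X Y) (a, b) / (prob P X a * prob P Y b).

Definition cmi_density (A B C : finType) (X : T -> A) (Y : T -> B) (Z : T -> C)
    a b c : R :=
  condprob P (rvpair X Y) Z (a, b) c / (condprob P X Z a c * condprob P Y Z b c).

Lemma mutual_info_mean (A B : finType) (X : T -> A) (Y : T -> B) :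
  `I[P](X ; Y) = \sum_t P t * ln (mi_density X Y (X t) (Y t)).
Proof. by rewrite -(sum_prob_pair X Y (fun a b => ln (mi_density X Y a b))). Qed.

Lemma cond_mutual_info_mean (A B C : finType) (X : T -> A) (Y : T -> B) (Z : T -> C) :
  `I[P](X ; Y | Z) = \sum_t P t * ln (cmi_density X Y Z (X t) (Y t) (Z t)).
Proof.
rewrite -(sum_prob_pair (rvpair X Y) Z (fun q c => ln (cmi_density X Y Z q.1 q.2 c))).
by rewrite /cond_mutual_info pair_bigA /=; apply: eq_bigr => -[a b] _.
Qed.

Lemma cond_entropy_mean (A C : finType) (X : T -> A) (Z : T -> C) :
  `H[P](X | Z) = \sum_t P t * ln (condprob P X Z (X t) (Z t))^-1.
Proof.
rewrite /cond_entropy (sum_prob_pair X Z (fun a c => ln (condprob P X Z a c))).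
rewrite -sumrN; apply: eq_bigr => t _; rewrite -mulrN; congr (_ * _).
have [c0|le0] := ltP 0 (condprob P X Z (X t) (Z t)); first by rewrite lnV.
(* At conditional probability 0 both sides vanish by the default values of the inverse and of the
   logarithm at 0. *)
have -> : condprob P X Z (X t) (Z t) = 0.
  by apply/eqP; rewrite eq_le le0 /condprob divr_ge0 ?prob_ge0.
by rewrite invr0 ln0 // oppr0.
Qed.

Lemma condprob_gt0 (A C : finType) (X : T -> A) (Z : T -> C) t :
  0 < P t -> 0 < condprob P X Z (X t) (Z t).
Proof.
by move=> Pt; rewrite divr_gt0 ?prob_gt0.
Qed.

Lemma mi_density_ge0 (A B : finType) (X : T -> A) (Y : T -> B) a b :
  0 <= mi_density X Y a b.
Proof. by rewrite divr_ge0 ?mulr_ge0 ?prob_ge0. Qed.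

Lemma cmi_density_ge0 (A B C : finType) (X : T -> A) (Y : T -> B) (Z : T -> C) a b c :
  0 <= cmi_density X Y Z a b c.
Proof. by rewrite /cmi_density /condprob !(divr_ge0, mulr_ge0) ?prob_ge0. Qed.

Lemma mi_density_gt0 (A B : finType) (X : T -> A) (Y : T -> B) t :
  0 < P t -> 0 < mi_density X Y (X t) (Y t).
Proof.
by move=> Pt; rewrite divr_gt0 ?mulr_gt0 ?prob_gt0.
Qed.

Lemma cmi_density_gt0 (A B C : finType) (X : T -> A) (Y : T -> B) (Z : T -> C) t :
  0 < P t -> 0 < cmi_density X Y Z (X t) (Y t) (Z t).
Proof.
move=> Pt; apply: divr_gt0; first exact: (condprob_gt0 (rvpair X Y)); apply: mulr_gt0.
  exact: condprob_gt0.
exact: condprob_gt0.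
Qed.

Hypothesis P_sum1 : \sum_t P t = 1.

(** Change of measure: the rival is independent of [Y], and the density turns the product law back
    into the joint law, of mass 1. Points of zero marginal account for the inequality. *)
Lemma mi_density_rival (A B : finType) (X : T -> A) (Y : T -> B) :
  \sum_t P t * (\sum_a prob P X a * mi_density X Y a (Y t)) <= 1.
Proof.
rewrite -(sum_prob Y (fun b => \sum_a prob P X a * mi_density X Y a b)).
rewrite -P_sum1 -(sum_prob1 (rvpair X Y)).
under eq_bigr => b _ do rewrite big_distrr /=.
rewrite exchange_big pair_bigA /=; apply: ler_sum => -[a b] _ /=.
rewrite /mi_density; set p := prob P X a; set q := prob P Y b.
have [->|q0] := eqVneq q 0; first by rewrite mul0r prob_ge0.
have [->|p0] := eqVneq p 0; first by rewrite mul0r mulr0 prob_ge0.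
by rewrite le_eqVlt; apply/orP; left; apply/eqP; field; rewrite p0 q0.
Qed.

(** The same change of measure given [Z]. The kernel [q] is any version of the conditional law of
    [X], since rivals are drawn from the kernels of the codebook and not from a quotient of
    probabilities. *)
Lemma cmi_density_rival (A B C : finType) (X : T -> A) (Y : T -> B) (Z : T -> C)
    (q : C -> A -> R) :
  (forall a c, prob P (rvpair X Z) (a, c) = q c a * prob P Z c) ->
  \sum_t P t * (\sum_a q (Z t) a * cmi_density X Y Z a (Y t) (Z t)) <= 1.
Proof.
move=> XZ; rewrite -(sum_prob_pair Y Z
  (fun b c => \sum_a q c a * cmi_density X Y Z a b c)).
rewrite -P_sum1 -(sum_prob1 (rvpair (rvpair X Y) Z)) pair_bigA /=.
under eq_bigr => bc _ do rewrite big_distrr /=.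
rewrite exchange_big pair_bigA /=.
pose f (s : A * B * C) := (s.1.1, (s.1.2, s.2)).
rewrite (reindex f) /=; last first.
  by apply: onW_bij; exists (fun s => (s.1, s.2.1, s.2.2)) => [[[]]|[? []]].
apply: ler_sum => -[[a b] c] _ /=; rewrite /cmi_density /condprob XZ.
set r := prob P _ ((a, b), c); have r0 : 0 <= r by exact: prob_ge0.
set s := prob P _ (b, c); set p := prob P Z c.
have [->|s0] := eqVneq s 0; first by rewrite mul0r.
have p0 : p != 0.
  apply: contraNneq s0 => p0; rewrite eq_le prob_ge0 andbT -p0.
  exact: prob_pair_le.
have [->|q0] := eqVneq (q c a) 0; first by rewrite mul0r mulr0.
by rewrite le_eqVlt; apply/orP; left; apply/eqP; field; rewrite ?p0 ?q0 ?s0.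
Qed.

(** Jensen's inequality, through ln x <= x - 1. *)
Lemma mean_ln_le0 (f : T -> R) :
  (forall t, 0 < P t -> 0 < f t) -> \sum_t P t * f t <= 1 ->
  \sum_t P t * ln (f t) <= 0.
Proof.
move=> f0 f1; apply: (@le_trans _ _ (\sum_t P t * (f t - 1))).
  apply: ler_sum => t _; have := P_ge0 t; rewrite le_eqVlt => /orP[/eqP <-|Pt].
    by rewrite !mul0r.
  rewrite ler_pM2l //; have := f0 t Pt => ft.
  by rewrite -[in leLHS] (subrKC 1 (f t)) le_ln1Dx // ltrBrDl subrr.
under eq_bigr do rewrite mulrBr mulr1.
by rewrite sumrB P_sum1 subr_le0.
Qed.

Lemma mutual_info_ge0 (A B : finType) (X : T -> A) (Y : T -> B) : 0 <= `I[P](X ; Y).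
Proof.
rewrite mutual_info_mean -oppr_le0 -sumrN.
have -> : \sum_t - (P t * ln (mi_density X Y (X t) (Y t))) =
    \sum_t P t * ln (mi_density X Y (X t) (Y t))^-1.
  apply: eq_bigr => t _; have := P_ge0 t.
  rewrite le_eqVlt => /orP[/eqP <-|lt]; first by rewrite !mul0r oppr0.
  by rewrite lnV ?mulrN // posrE mi_density_gt0.
apply: mean_ln_le0 => [t lt|]; first by rewrite invr_gt0 mi_density_gt0.
rewrite -(sum_prob_pair X Y (fun a b => (mi_density X Y a b)^-1)).
apply: (@le_trans _ _ (\sum_a \sum_b prob P X a * prob P Y b)).
  apply: ler_sum => a _; apply: ler_sum => b _; rewrite /mi_density invf_div.
  set p := prob P _ (a, b).
  have [->|p0] := eqVneq p 0; first by rewrite mul0r mulr_ge0 ?prob_ge0.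
  by rewrite mulrC divfK.
under eq_bigr => a _ do rewrite -big_distrr /= sum_prob1 P_sum1 mulr1.
by rewrite sum_prob1 P_sum1.
Qed.

End Densities.

(** * Marginals of the joint law *)

Section Means.
Context {R : realType} {A : finType}.
Implicit Types (p F : A -> R).

Lemma mean_cst p F c : is_pmf p -> (forall a, F a = c) -> \sum_a p a * F a = c.
Proof.
by move=> [_ p1] Fc; under eq_bigr do rewrite Fc; rewrite -big_distrl /= p1 mul1r.
Qed.

Lemma mean_at p F c a : F a = c -> (forall b, b != a -> F b = 0) ->
  \sum_b p b * F b = p a * c.
Proof.
by move=> <- F0; rewrite (bigD1 a) //= big1 ?addr0 // => b /F0 ->; rewrite mulr0.
Qed.

End Means.

Section Marginals.
Context {R : realType} {U V X1 X2 Y : finType}.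
Variables (PU : U -> R) (PV : V -> R) (PX1 : U * V -> X1 -> R)
  (PX2 : X2 -> R) (PX2c : U -> X2 -> R) (W : X1 -> X2 -> Y -> R).
Hypotheses (hU : is_pmf PU) (hV : is_pmf PV) (hX1 : is_kernel PX1)
  (hX2 : is_pmf PX2) (hX2c : is_kernel PX2c) (hW : is_mac W).
Local Notation omega := (U * V * X1 * X2 * X2 * Y * Y)%type.
Local Notation law := (joint_law PU PV PX1 PX2 PX2c W).

Lemma joint_law_ge0 t : 0 <= law t.
Proof.
case: t => [[[[[[u v] x1] x2] xc] y] yc] /=.
by rewrite !mulr_ge0 //; solve [exact: hU.1|exact: hV.1|exact: (hX1 _).1|
  exact: hX2.1|exact: (hX2c _).1|exact: (hW _ _).1].
Qed.

(** Marginals are computed on this iterated form from the outside inward: [mean_at] selects a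
    prescribed coordinate, [mean_cst] integrates out a free one. *)
Lemma mean_joint_law (F : omega -> R) :
  \sum_t law t * F t =
  \sum_u PU u * (\sum_v PV v * (\sum_x1 PX1 (u, v) x1 * (\sum_x2 PX2 x2 *
  (\sum_xc PX2c u xc * (\sum_y W x1 x2 y * (\sum_yc W x1 xc yc *
    F (u, v, x1, x2, xc, y, yc))))))).
Proof.
rewrite sum_prod7; apply: eq_bigr => u _.
rewrite big_distrr; apply: eq_bigr => v _ /=.
rewrite mulrA big_distrr; apply: eq_bigr => x1 _ /=.
rewrite mulrA big_distrr; apply: eq_bigr => x2 _ /=.
rewrite mulrA big_distrr; apply: eq_bigr => xc _ /=.
rewrite mulrA big_distrr; apply: eq_bigr => y _ /=.
rewrite mulrA big_distrr; apply: eq_bigr => yc _ /=.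
by ring.
Qed.

Ltac integrate1 := apply: mean_cst;
  [solve [exact: hU|exact: hV|exact: hX1|exact: hX2|exact: hX2c|exact: hW]|
   move=> ?].
Ltac integrate := repeat integrate1.

Lemma joint_law_sum1 : \sum_t law t = 1.
Proof.
have := mean_joint_law (fun=> 1); under eq_bigr do rewrite mulr1.
by move->; integrate.
Qed.

Lemma prob_mean (T A : finType) (P : T -> R) (X : T -> A) a :
  prob P X a = \sum_t P t * (X t == a)%:R.
Proof.
by rewrite /prob big_mkcond; apply: eq_bigr => t _; case: eqP; rewrite ?mulr1 ?mulr0.
Qed.

Lemma prob_V v : prob law rvV v = PV v.
Proof.
rewrite prob_mean mean_joint_law -[RHS]mulr1; integrate1.
by apply: mean_at => [|v' vv']; integrate; rewrite /= ?eqxx ?(negbTE vv').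
Qed.

Lemma prob_X2 x2 : prob law rvX2 x2 = PX2 x2.
Proof.
rewrite prob_mean mean_joint_law -[RHS]mulr1; do 3 integrate1.
by apply: mean_at => [|b ne]; integrate; rewrite /= ?eqxx ?(negbTE ne).
Qed.

Lemma prob_VX2 v x2 : prob law (rvpair rvV rvX2) (v, x2) = PV v * PX2 x2.
Proof.
rewrite prob_mean mean_joint_law; integrate1.
apply: mean_at => [|b ne]; last by integrate; rewrite /= xpair_eqE (negbTE ne).
integrate1; rewrite -[RHS]mulr1.
by apply: mean_at => [|b ne]; integrate; rewrite /= xpair_eqE ?(negbTE ne) ?eqxx ?andbF.
Qed.

Lemma prob_UV u v : prob law (rvpair rvU rvV) (u, v) = PU u * PV v.
Proof.
rewrite prob_mean mean_joint_law.
apply: mean_at => [|b ne]; last by integrate; rewrite /= xpair_eqE (negbTE ne).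
rewrite -[RHS]mulr1.
by apply: mean_at => [|b ne]; integrate; rewrite /= xpair_eqE ?(negbTE ne) ?eqxx ?andbF.
Qed.

Lemma prob_X1UV x1 u v :
  prob law (rvpair rvX1 (rvpair rvU rvV)) (x1, (u, v)) = PU u * (PV v * PX1 (u, v) x1).
Proof.
rewrite prob_mean mean_joint_law.
apply: mean_at => [|b ne]; last by integrate; rewrite /= !xpair_eqE (negbTE ne) ?andbF.
apply: mean_at => [|b ne]; last by integrate; rewrite /= !xpair_eqE (negbTE ne) ?andbF.
rewrite -[RHS]mulr1.
by apply: mean_at => [|b ne]; integrate; rewrite /= !xpair_eqE ?(negbTE ne) ?eqxx ?andbF.
Qed.

Lemma prob_X2cUVX1 x2 u v x1 :
  prob law (rvpair rvX2c (rvpair (rvpair rvU rvV) rvX1)) (x2, ((u, v), x1)) =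
  PU u * (PV v * (PX1 (u, v) x1 * PX2c u x2)).
Proof.
rewrite prob_mean mean_joint_law.
apply: mean_at => [|b ne]; last by integrate; rewrite /= !xpair_eqE (negbTE ne) ?andbF.
apply: mean_at => [|b ne]; last by integrate; rewrite /= !xpair_eqE (negbTE ne) ?andbF.
apply: mean_at => [|b ne]; last by integrate; rewrite /= !xpair_eqE (negbTE ne) ?andbF.
rewrite -[RHS]mulr1; integrate1.
by apply: mean_at => [|b ne]; integrate; rewrite /= !xpair_eqE ?(negbTE ne) ?eqxx ?andbF.
Qed.

Lemma prob_X1X2cV x1 x2 v :
  prob law (rvpair (rvpair rvX1 rvX2c) rvV) ((x1, x2), v) =
  (\sum_u PU u * (PX1 (u, v) x1 * PX2c u x2)) * PV v.
Proof.
rewrite prob_mean mean_joint_law big_distrl /=; apply: eq_bigr => u _.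
rewrite -mulrA [_ * PV v]mulrC; congr (_ * _).
apply: mean_at => [|b ne]; last by integrate; rewrite /= !xpair_eqE (negbTE ne) ?andbF.
apply: mean_at => [|b ne]; last by integrate; rewrite /= !xpair_eqE (negbTE ne) ?andbF.
rewrite -[RHS]mulr1; integrate1.
by apply: mean_at => [|b ne]; integrate; rewrite /= !xpair_eqE ?(negbTE ne) ?eqxx ?andbF.
Qed.

(** [Z] ignores the outputs and determines the inputs through [f] and [g], so given [Z] the output
    follows [W]. Applied with and without [V] in [Z], this is the Markov property of V, (X1,X2c),
    Yc. *)
Lemma prob_Yc (A : finType) (Z : omega -> A) (f : A -> X1) (g : A -> X2) z y :
  (forall u v x1 x2 xc y y' yc yc',
     Z (u, v, x1, x2, xc, y, yc) = Z (u, v, x1, x2, xc, y', yc')) ->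
  (forall t, f (Z t) = rvX1 t) -> (forall t, g (Z t) = rvX2c t) ->
  prob law (rvpair Z rvYc) (z, y) = W (f z) (g z) y * prob law Z z.
Proof.
move=> Zy fZ gZ; rewrite !prob_mean big_distrr /=.
transitivity (\sum_t law t * (W (f z) (g z) y * (Z t == z)%:R)); last first.
  by apply: eq_bigr => t _; rewrite mulrCA.
rewrite !mean_joint_law; apply: eq_bigr => u _; congr (_ * _).
apply: eq_bigr => v _; congr (_ * _); apply: eq_bigr => x1 _; congr (_ * _).
apply: eq_bigr => x2 _; congr (_ * _); apply: eq_bigr => xc _; congr (_ * _).
apply: eq_bigr => y1 _; congr (_ * _).
transitivity (W x1 xc y * (Z (u, v, x1, x2, xc, y1, y) == z)%:R).
  apply: mean_at => [|b ne].
    by rewrite xpair_eqE eqxx andbT.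
  by rewrite xpair_eqE /= (negbTE ne) andbF.
symmetry; apply: mean_cst => [|yc]; first exact: hW.
rewrite (Zy _ _ _ _ _ y1 y1 yc y); case: eqP => [<-|_]; last by rewrite !mulr0.
by rewrite fZ gZ.
Qed.

Lemma mean_X2Y (G : V -> X1 -> X2 -> Y -> R) :
  \sum_t law t * G (rvV t) (rvX1 t) (rvX2 t) (rvY t) =
  \sum_t law t * (\sum_x2 PX2 x2 *
    (\sum_y W (rvX1 t) x2 y * G (rvV t) (rvX1 t) x2 y)).
Proof.
rewrite !mean_joint_law; apply: eq_bigr => u _; congr (_ * _).
apply: eq_bigr => v _; congr (_ * _); apply: eq_bigr => x1 _; congr (_ * _) => /=.
transitivity (\sum_x2 PX2 x2 * (\sum_y W x1 x2 y * G v x1 x2 y)).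
  apply: eq_bigr => x2 _; congr (_ * _); integrate1.
  by apply: eq_bigr => y _; congr (_ * _); integrate.
by symmetry; do 4 integrate1.
Qed.

End Marginals.

(** * Single-letter densities and two information inequalities *)

Section SingleLetter.
Context {R : realType} {U V X1 X2 Y : finType}.
Variables (PU : U -> R) (PV : V -> R) (PX1 : U * V -> X1 -> R)
  (PX2 : X2 -> R) (PX2c : U -> X2 -> R) (W : X1 -> X2 -> Y -> R).
Hypotheses (hU : is_pmf PU) (hV : is_pmf PV) (hX1 : is_kernel PX1)
  (hX2 : is_pmf PX2) (hX2c : is_kernel PX2c) (hW : is_mac W).
Local Notation omega := (U * V * X1 * X2 * X2 * Y * Y)%type.
Local Notation law := (joint_law PU PV PX1 PX2 PX2c W).

Definition densA1 v x2 y := cmi_density law rvV rvY rvX2 v y x2.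
Definition densA2 v x2 y := cmi_density law rvX2 rvY rvV x2 y v.
Definition densA3 v x2 y := mi_density law (rvpair rvV rvX2) rvY (v, x2) y.
Definition densC1 v x1 := mi_density law rvV rvX1 v x1.
Definition densC2 u v x1 := (condprob law rvX1 (rvpair rvU rvV) x1 (u, v))^-1.
Definition densB1 v y := mi_density law rvV rvYc v y.
Definition densB2 v x1 x2 y := cmi_density law (rvpair rvX1 rvX2c) rvYc rvV (x1, x2) y v.
Definition densB3 u v x1 x2 y :=
  cmi_density law rvX2c rvYc (rvpair (rvpair rvU rvV) rvX1) x2 y ((u, v), x1).

Let law_ge0 := joint_law_ge0 hU hV hX1 hX2 hX2c hW.
Let law_sum1 := joint_law_sum1 hU hV hX1 hX2 hX2c hW.

Lemma rival_A1 : \sum_t law t * (\sum_v PV v * densA1 v (rvX2 t) (rvY t)) <= 1.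
Proof.
apply: (cmi_density_rival law_ge0 law_sum1 rvY (q := fun _ => PV)) => v x2.
by rewrite prob_VX2 // prob_X2.
Qed.

Lemma rival_A2 : \sum_t law t * (\sum_x2 PX2 x2 * densA2 (rvV t) x2 (rvY t)) <= 1.
Proof.
apply: (cmi_density_rival law_ge0 law_sum1 rvY (q := fun _ => PX2)) => x2 v.
by rewrite probC prob_VX2 // prob_V // mulrC.
Qed.

Lemma rival_A3 :
  \sum_t law t * (\sum_v PV v * \sum_x2 PX2 x2 * densA3 v x2 (rvY t)) <= 1.
Proof.
apply: le_trans (mi_density_rival law_ge0 law_sum1 (rvpair rvV rvX2) rvY).
rewrite le_eqVlt; apply/orP; left; apply/eqP; apply: eq_bigr => t _; congr (_ * _).
under eq_bigr => v _ do rewrite big_distrr /=.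
by rewrite pair_bigA /=; apply: eq_bigr => -[v x2] _; rewrite prob_VX2 // mulrA.
Qed.

Lemma rival_C1 : \sum_t law t * (\sum_v PV v * densC1 v (rvX1 t)) <= 1.
Proof.
apply: le_trans (mi_density_rival law_ge0 law_sum1 rvV rvX1).
by under [leRHS]eq_bigr => t _ do under eq_bigr => v _ do rewrite prob_V //.
Qed.

Lemma rival_C2 :
  \sum_t law t * (PX1 (rvU t, rvV t) (rvX1 t) * densC2 (rvU t) (rvV t) (rvX1 t)) <= 1.
Proof.
rewrite -law_sum1; apply: ler_sum => t _; rewrite -[leRHS]mulr1.
apply: ler_wpM2l; first exact: law_ge0.
rewrite /densC2 /condprob prob_X1UV // prob_UV //.
set a := PU _; set b := PV _; set c := PX1 _ _.
have [->|c0] := eqVneq c 0; first by rewrite mul0r.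
have [->|a0] := eqVneq a 0; first by rewrite !(mul0r, invr0, mulr0).
have [->|b0] := eqVneq b 0; first by rewrite !(mul0r, invr0, mulr0).
by rewrite le_eqVlt; apply/orP; left; apply/eqP; field; rewrite ?a0 ?b0 ?c0.
Qed.

Lemma rival_B1 : \sum_t law t * (\sum_v PV v * densB1 v (rvYc t)) <= 1.
Proof.
apply: le_trans (mi_density_rival law_ge0 law_sum1 rvV rvYc).
by under [leRHS]eq_bigr => t _ do under eq_bigr => v _ do rewrite prob_V //.
Qed.

(** A wrong state has a fresh [u], hence fresh [x1] and [xc]. Averaged over [u], they follow the
    conditional law of (X1,X2c) given V, because U and V are independent. *)
Lemma rival_B2 :
  \sum_t law t * (\sum_u PU u * \sum_x1 PX1 (u, rvV t) x1 *
    \sum_xc PX2c u xc * densB2 (rvV t) x1 xc (rvYc t)) <= 1.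
Proof.
pose q v (x : X1 * X2) := \sum_u PU u * (PX1 (u, v) x.1 * PX2c u x.2).
apply: le_trans (cmi_density_rival law_ge0 law_sum1 (X := rvpair rvX1 rvX2c)
  rvYc (Z := rvV) (q := q) _); last first.
  by move=> [x1 x2] v; rewrite prob_X1X2cV // prob_V.
rewrite le_eqVlt; apply/orP; left; apply/eqP; apply: eq_bigr => t _; congr (_ * _).
under [RHS]eq_bigr => x _ do rewrite /q big_distrl /=.
rewrite [RHS]exchange_big /=; apply: eq_bigr => u _.
rewrite -(pair_bigA _ (fun x1 x2 => PU u * (PX1 (u, rvV t) x1 * PX2c u x2) *
  cmi_density law (rvpair rvX1 rvX2c) rvYc rvV (x1, x2) (rvYc t) (rvV t))) /=.
rewrite big_distrr /=; apply: eq_bigr => x1 _.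
by rewrite !big_distrr /=; apply: eq_bigr => x2 _; rewrite !mulrA.
Qed.

Lemma rival_B3 :
  \sum_t law t * (\sum_xc PX2c (rvU t) xc *
    densB3 (rvU t) (rvV t) (rvX1 t) xc (rvYc t)) <= 1.
Proof.
apply: (cmi_density_rival law_ge0 law_sum1 (X := rvX2c) rvYc
  (Z := rvpair (rvpair rvU rvV) rvX1) (q := fun s => PX2c s.1.1)) => x2 [[u v] x1].
rewrite prob_X2cUVX1 // probC prob_X1UV //=; ring.
Qed.

(** The difference is the mean logarithm of the ratio [f] of the two densities, so a mean of [f] at
    most 1 suffices. Dividing by [densC1] makes V and X1 independent, and for independent V and X1
    the mean of [densA1] is bounded by [rival_A1]. *)
Lemma data_processing : `I[law](rvV ; rvY | rvX2) <= `I[law](rvV ; rvX1).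
Proof.
rewrite cond_mutual_info_mean // mutual_info_mean // -subr_le0 -sumrB.
pose f (t : omega) := densA1 (rvV t) (rvX2 t) (rvY t) / densC1 (rvV t) (rvX1 t).
have A0 t : 0 < law t -> 0 < densA1 (rvV t) (rvX2 t) (rvY t) by exact: cmi_density_gt0.
have C0 t : 0 < law t -> 0 < densC1 (rvV t) (rvX1 t) by exact: mi_density_gt0.
have -> : \sum_t (law t * ln (cmi_density law rvV rvY rvX2 (rvV t) (rvY t) (rvX2 t)) -
    law t * ln (mi_density law rvV rvX1 (rvV t) (rvX1 t))) = \sum_t law t * ln (f t).
  apply: eq_bigr => t _; rewrite -mulrBr; have := law_ge0 t.
  rewrite le_eqVlt => /orP[/eqP <-|lt]; first by rewrite !mul0r.
  by rewrite /f ln_div // posrE; [exact: A0|exact: C0].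
apply: mean_ln_le0 => // [t lt|]; first by rewrite divr_gt0 ?A0 ?C0.
(* Mean of [densA1 v] over (X2,Y) given X1 = [x1]; it is the same for every V because X2 is
   independent of (V,X1). *)
pose Q v x1 := \sum_x2 PX2 x2 * (\sum_y W x1 x2 y * densA1 v x2 y).
have Q0 v x1 : 0 <= Q v x1.
  apply: sumr_ge0 => x2 _; rewrite mulr_ge0 ?hX2.1 //; apply: sumr_ge0 => y _.
  by rewrite mulr_ge0 ?(hW _ _).1 // cmi_density_ge0.
have -> : \sum_t law t * f t =
    \sum_t law t * (Q (rvV t) (rvX1 t) / densC1 (rvV t) (rvX1 t)).
  rewrite /f (mean_X2Y PU PV PX1 hX2 hX2c hW (fun v x1 x2 y => densA1 v x2 y / densC1 v x1)).
  apply: eq_bigr => t _; congr (_ * _); rewrite /Q big_distrl /=.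
  apply: eq_bigr => x2 _; rewrite -mulrA big_distrl /=; congr (_ * _).
  by apply: eq_bigr => y _; rewrite mulrA.
apply: le_trans rival_A1.
rewrite -(sum_prob_pair law rvV rvX1 (fun v x1 => Q v x1 / densC1 v x1)).
have -> : \sum_t law t * (\sum_v PV v * densA1 v (rvX2 t) (rvY t)) =
    \sum_v \sum_x1 PV v * prob law rvX1 x1 * Q v x1.
  under eq_bigr => t _ do rewrite big_distrr /=.
  rewrite exchange_big /=; apply: eq_bigr => v _.
  under eq_bigr => t _ do rewrite mulrCA.
  rewrite -big_distrr /= (mean_X2Y PU PV PX1 hX2 hX2c hW (fun _ _ x2 y => densA1 v x2 y)).
  rewrite -(sum_prob law rvX1 (Q v)) big_distrr /=.
  by apply: eq_bigr => x1 _; rewrite mulrA.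
apply: ler_sum => v _; apply: ler_sum => x1 _.
rewrite /densC1 /mi_density prob_V // invf_div.
set p := prob law _ (v, x1).
have r0 : 0 <= PV v * prob law rvX1 x1 * Q v x1.
  by rewrite !mulr_ge0 ?hV.1 ?prob_ge0.
have [->|p0] := eqVneq p 0; first by rewrite mul0r.
by rewrite le_eqVlt; apply/orP; left; apply/eqP; field; rewrite p0.
Qed.

(** Since V acts on Yc only through the inputs, adding V to (X1,X2c) does not change their density
    with Yc; hence the densities multiply at each point of the support. *)
Lemma chain_rule :
  `I[law](rvpair rvX1 rvX2c ; rvYc) <=
  `I[law](rvV ; rvYc) + `I[law](rvpair rvX1 rvX2c ; rvYc | rvV).
Proof.
rewrite cond_mutual_info_mean // !mutual_info_mean // -big_split /=.
apply: ler_sum => t _; rewrite -mulrDr.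
have := law_ge0 t; rewrite le_eqVlt => /orP[/eqP <-|lt]; first by rewrite !mul0r.
apply: ler_wpM2l; first exact: ltW.
rewrite -lnM ?posrE; [|exact: mi_density_gt0|exact: cmi_density_gt0].
set l := mi_density _ _ _ _ _; suff -> : l = mi_density law rvV rvYc (rvV t) (rvYc t) *
  cmi_density law (rvpair rvX1 rvX2c) rvYc rvV (rvpair rvX1 rvX2c t) (rvYc t) (rvV t) by [].
rewrite /l /mi_density /cmi_density /condprob.
have pXV : 0 < prob law (rvpair (rvpair rvX1 rvX2c) rvV) ((rvX1 t, rvX2c t), rvV t).
  exact: (prob_gt0 law_ge0 (rvpair (rvpair rvX1 rvX2c) rvV)).
have pX : 0 < prob law (rvpair rvX1 rvX2c) (rvX1 t, rvX2c t).
  exact: (prob_gt0 law_ge0 (rvpair rvX1 rvX2c)).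
have pVY : 0 < prob law (rvpair rvV rvYc) (rvV t, rvYc t).
  exact: (prob_gt0 law_ge0 (rvpair rvV rvYc)).
have pY : 0 < prob law rvYc (rvYc t) by exact: prob_gt0.
have pV : 0 < prob law rvV (rvV t) by exact: prob_gt0.
have -> : prob law (rvpair (rvpair rvX1 rvX2c) rvYc) (rvpair rvX1 rvX2c t, rvYc t) =
    W (rvX1 t) (rvX2c t) (rvYc t) * prob law (rvpair rvX1 rvX2c) (rvX1 t, rvX2c t).
  by rewrite (prob_Yc PU PV PX1 PX2 PX2c hW (f := fst) (g := snd)).
have -> : prob law (rvpair (rvpair (rvpair rvX1 rvX2c) rvYc) rvV)
     ((rvpair rvX1 rvX2c t, rvYc t), rvV t) =
    W (rvX1 t) (rvX2c t) (rvYc t) *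
    prob law (rvpair (rvpair rvX1 rvX2c) rvV) ((rvX1 t, rvX2c t), rvV t).
  have <- := prob_Yc PU PV PX1 PX2 PX2c hW (Z := rvpair (rvpair rvX1 rvX2c) rvV)
    (f := fun z => z.1.1) (g := fun z => z.1.2) ((rvX1 t, rvX2c t), rvV t) (rvYc t)
    (fun _ _ _ _ _ _ _ _ _ => erefl) (fun _ => erefl) (fun _ => erefl).
  by apply: eq_bigl => s; rewrite !xpair_eqE -!andbA; do !bool_congr.
rewrite [prob law (rvpair rvYc rvV) _]probC.
rewrite /rvpair in pXV pX pVY pY pV *.
move: pXV pX pVY pY pV => /gt_eqF/negbT h1 /gt_eqF/negbT h2 /gt_eqF/negbT h3
  /gt_eqF/negbT h4 /gt_eqF/negbT h5.
by field; rewrite ?h1 ?h2 ?h3 ?h4 ?h5.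
Qed.

End SingleLetter.

(** * Product laws *)

Section LawOfLargeNumbers.
Context {R : realType} {T : finType} (P : T -> R).
Hypothesis hP : is_pmf P.

Definition power_law (n : nat) (t : n.-tuple T) : R := \prod_i P (tnth t i).

Lemma power_law_ge0 n (t : n.-tuple T) : 0 <= power_law t.
Proof. by apply: prodr_ge0 => i _; exact: hP.1. Qed.

Lemma second_moment n (psi : T -> R) : \sum_x P x * psi x = 0 ->
  \sum_(t : n.-tuple T) power_law t * (\sum_i psi (tnth t i)) ^+ 2 =
  n%:R * \sum_x P x * psi x ^+ 2.
Proof.
move=> psi0.
transitivity (\sum_(i < n) \sum_(j < n) \sum_(t : n.-tuple T)
    power_law t * (psi (tnth t i) * psi (tnth t j))).
  under [RHS]eq_bigr => i _ do rewrite exchange_big /=.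
  rewrite [RHS]exchange_big /=; apply: eq_bigr => t _.
  rewrite expr2 big_distrl big_distrr /=; apply: eq_bigr => i _.
  by rewrite !big_distrr.
have cross (i j : 'I_n) : \sum_(t : n.-tuple T)
    power_law t * (psi (tnth t i) * psi (tnth t j)) =
    (i == j)%:R * \sum_x P x * psi x ^+ 2.
  pose h (k : 'I_n) x := (if k == i then psi x else 1) * (if k == j then psi x else 1).
  transitivity (\prod_k \sum_x P x * h k x).
    rewrite -(sum_tuple_prodM (fun=> P) h); apply: eq_bigr => t _; congr (_ * _).
    rewrite big_split /=; congr (_ * _).
      by rewrite (bigD1 i) //= eqxx big1 ?mulr1 // => k /negbTE ->.
    by rewrite (bigD1 j) //= eqxx big1 ?mulr1 // => k /negbTE ->.
  case: (eqVneq i j) => [eij|ij].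
    subst j; rewrite (bigD1 i) //= /h !eqxx [\prod_(_ | _) _]big1 => [|k /negbTE ->].
      by rewrite mulr1 mul1r; apply: eq_bigr => x _; rewrite expr2.
    by rewrite -[RHS]hP.2; apply: eq_bigr => x _ /=; rewrite !mulr1.
  rewrite (bigD1 i) //= /h eqxx (negbTE ij).
  under [X in X * _]eq_bigr do rewrite mulr1.
  by rewrite psi0 !mul0r.
under eq_bigr => i _ do under eq_bigr => j _ do rewrite cross.
under eq_bigr => i _ do rewrite sum_delta.
by rewrite sumr_const card_ord mulr_natl.
Qed.

Lemma weak_law (phi : T -> R) (delta eps : R) : 0 < delta -> 0 < eps ->
  \forall n \near \oo, \sum_(t : n.-tuple T) power_law t *
    (\sum_i phi (tnth t i) < n%:R * (\sum_x P x * phi x - delta))%R%:R <= eps.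
Proof.
move=> delta0 eps0; set mu := \sum_x P x * phi x.
pose psi x := phi x - mu; pose var := \sum_x P x * psi x ^+ 2.
have psi0 : \sum_x P x * psi x = 0.
  under eq_bigr do rewrite mulrBr.
  by rewrite sumrB -big_distrl /= hP.2 mul1r subrr.
near=> n.
have n0 : 0 < n%:R :> R by rewrite ltr0n; near: n; exact: nbhs_infty_gt.
(* Chebyshev's inequality: second moment [n * var] against the squared deviation
   [(n * delta) ^+ 2]. *)
have nvar : var / (eps * delta ^+ 2) <= n%:R by near: n; exact: near_ge_natr.
have nd : 0 < n%:R * delta by rewrite mulr_gt0.
have nd0 : 0 < (n%:R * delta) ^+ 2 by rewrite exprn_gt0 // mulr_gt0.
apply: (@le_trans _ _ (\sum_(t : n.-tuple T) power_law t *
    ((\sum_i psi (tnth t i)) ^+ 2 / (n%:R * delta) ^+ 2))).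
  apply: ler_sum => t _; apply: ler_wpM2l; first exact: power_law_ge0.
  case: ltP => [lt|_]; last by rewrite divr_ge0 ?sqr_ge0.
  rewrite ler_pdivlMr // mul1r /psi sumrB sumr_const card_ord -mulr_natl.
  rewrite -[leRHS]sqrrN lerXn2r ?nnegrE ?mulr_ge0 //; try exact: ltW.
  + by move: lt; rewrite mulrBr; set s := \sum_i _; lra.
  + by move: lt; rewrite mulrBr; set s := \sum_i _; lra.
under eq_bigr do rewrite mulrA.
rewrite -big_distrl /= second_moment // ler_pdivrMr // exprMn.
move: nvar; rewrite ler_pdivrMr ?mulr_gt0 ?exprn_gt0 // -/var => h.
rewrite (_ : eps * (n%:R ^+ 2 * delta ^+ 2) =
  n%:R * (n%:R * (eps * delta ^+ 2))); last by ring.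
by rewrite ler_pM2l.
Unshelve. all: by end_near. Qed.

(** The weak law for [ln (r x)]. A word of positive weight has only letters of positive probability,
    where the logarithm is genuine. *)
Lemma density_weak_law (r : T -> R) (delta eps : R) :
  (forall x, 0 < P x -> 0 < r x) -> 0 < delta -> 0 < eps ->
  \forall n \near \oo, \sum_(t : n.-tuple T) power_law t *
    ((\prod_i r (tnth t i)) * expR (- (n%:R * (\sum_x P x * ln (r x) - delta))) < 1)%R%:R
    <= eps.
Proof.
move=> r0 delta0 eps0.
have [N _ h] := weak_law (fun x => ln (r x)) delta0 eps0.
exists N => // n /h; apply: le_trans; apply: ler_sum => t _.
have := power_law_ge0 t; rewrite le_eqVlt => /orP[/eqP <-|lt]; first by rewrite !mul0r.
have Pt i : 0 < P (tnth t i).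
  rewrite lt_neqAle hP.1 andbT eq_sym.
  by move: lt; rewrite lt_neqAle eq_sym => /andP[/prodf_neq0/(_ i)-> //].
apply: ler_wpM2l; first exact: ltW.
have -> : \prod_i r (tnth t i) = expR (\sum_i ln (r (tnth t i))).
  rewrite expR_sum; apply: eq_bigr => i _.
  by rewrite lnK // posrE r0.
by rewrite -expRD expR_lt1 subr_lt0.
Unshelve. all: by end_near. Qed.

End LawOfLargeNumbers.

(** * The joint law of words and the scores of words *)

Section ProductLaws.
Context {R : realType} {U V X1 X2 Y : finType}.
Variables (PU : U -> R) (PV : V -> R) (PX1 : U * V -> X1 -> R)
  (PX2 : X2 -> R) (PX2c : U -> X2 -> R) (W : X1 -> X2 -> Y -> R).
Hypotheses (hU : is_pmf PU) (hV : is_pmf PV) (hX1 : is_kernel PX1)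
  (hX2 : is_pmf PX2) (hX2c : is_kernel PX2c) (hW : is_mac W).
Variable n : nat.
Local Notation omega := (U * V * X1 * X2 * X2 * Y * Y)%type.
Local Notation "A ^n" := (n.-tuple A) (at level 2, format "A ^n").
Local Notation omegaN := (U^n * V^n * X1^n * X2^n * X2^n * Y^n * Y^n)%type.
Local Notation law := (joint_law PU PV PX1 PX2 PX2c W).

Definition power_X1 (s : U^n * V^n) (x : X1^n) : R :=
  \prod_i PX1 (tnth s.1 i, tnth s.2 i) (tnth x i).
Definition power_X2c (u : U^n) (x : X2^n) : R :=
  \prod_i PX2c (tnth u i) (tnth x i).

Lemma power_law_pmf (A : finType) (p : A -> R) : is_pmf p -> is_pmf (@power_law R A p n).
Proof.
move=> hp; split=> [t|]; first exact: power_law_ge0.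
by rewrite (sum_tuple_prod (fun=> p)) big1 // => i _; exact: hp.2.
Qed.

Lemma power_X1_kernel : is_kernel power_X1.
Proof.
move=> s; split=> [t|]; first by apply: prodr_ge0 => i _; exact: (hX1 _).1.
rewrite (sum_tuple_prod (fun i => PX1 (tnth s.1 i, tnth s.2 i))) big1 // => i _.
exact: (hX1 _).2.
Qed.

Lemma power_X2c_kernel : is_kernel power_X2c.
Proof.
move=> u; split=> [t|]; first by apply: prodr_ge0 => i _; exact: (hX2c _).1.
rewrite (sum_tuple_prod (fun i => PX2c (tnth u i))) big1 // => i _.
exact: (hX2c _).2.
Qed.

(** The product law written as a [joint_law] over words, so that the one-shot bound applies as it
    stands; [unzip7] identifies it with the power of the single-letter law. *)
Definition lawN : omegaN -> R :=
  joint_law (@power_law R U PU n) (@power_law R V PV n) power_X1 (@power_law R X2 PX2 n)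
    power_X2c (@mac_law R X1 X2 Y W n).

Definition unzip7 (t : n.-tuple omega) : omegaN :=
  ([tuple rvU (tnth t i) | i < n], [tuple rvV (tnth t i) | i < n],
   [tuple rvX1 (tnth t i) | i < n], [tuple rvX2 (tnth t i) | i < n],
   [tuple rvX2c (tnth t i) | i < n], [tuple rvY (tnth t i) | i < n],
   [tuple rvYc (tnth t i) | i < n]).

Lemma unzip7_bij : bijective unzip7.
Proof.
exists (fun s : omegaN => let: (u, v, x1, x2, xc, y, yc) := s in
  [tuple (tnth u i, tnth v i, tnth x1 i, tnth x2 i, tnth xc i, tnth y i, tnth yc i)
  | i < n]).
  move=> t; apply: eq_from_tnth => i; rewrite !tnth_mktuple.
  by case: (tnth t i) => [[[[[[]]]]]].
move=> [[[[[[u v] x1] x2] xc] y] yc]; rewrite /unzip7; congr (_, _, _, _, _, _, _);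
  by apply: eq_from_tnth => i; rewrite !tnth_mktuple.
Qed.

Lemma lawN_unzip7 t : lawN (unzip7 t) = power_law law t.
Proof.
rewrite /lawN /joint_law /unzip7 /power_law /power_X1 /power_X2c /mac_law.
rewrite -!big_split /=; apply: eq_bigr => i _; rewrite !tnth_mktuple.
by case: (tnth t i) => [[[[[[u v] x1] x2] xc] y] yc].
Qed.

Lemma sum_lawN (F : omegaN -> R) :
  \sum_s lawN s * F s = \sum_t power_law law t * F (unzip7 t).
Proof.
rewrite (reindex unzip7); last exact: onW_bij unzip7_bij.
by apply: eq_bigr => t _; rewrite lawN_unzip7.
Qed.

(** By independence the mean of the product is the n-th power of a mean that is at most 1. *)
Lemma rival_product (G : omega -> R) (H : omegaN -> R) (c : R) :
  (forall t, 0 <= G t) -> 0 <= c -> \sum_t law t * G t <= 1 ->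
  (forall t, H (unzip7 t) = (\prod_i G (tnth t i)) * c) ->
  \sum_s lawN s * H s <= c.
Proof.
move=> G0 c0 G1 HG; rewrite sum_lawN.
under eq_bigr do rewrite HG mulrA.
rewrite -big_distrl /= (sum_tuple_prodM (fun=> law) (fun=> G)).
rewrite prodr_const -[leRHS]mul1r; apply: ler_wpM2r => //.
rewrite exprn_ile1 //; apply: sumr_ge0 => t _; rewrite mulr_ge0 //.
exact: joint_law_ge0.
Qed.

Variable c : R.
Hypothesis c_ge0 : 0 <= c.

Local Notation dA1 := (densA1 PU PV PX1 PX2 PX2c W).
Local Notation dA2 := (densA2 PU PV PX1 PX2 PX2c W).
Local Notation dA3 := (densA3 PU PV PX1 PX2 PX2c W).
Local Notation dC1 := (densC1 PU PV PX1 PX2 PX2c W).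
Local Notation dC2 := (densC2 PU PV PX1 PX2 PX2c W).
Local Notation dB1 := (densB1 PU PV PX1 PX2 PX2c W).
Local Notation dB2 := (densB2 PU PV PX1 PX2 PX2c W).
Local Notation dB3 := (densB3 PU PV PX1 PX2 PX2c W).

(** [c] is the inverse of the decoding threshold, later [expR (- (n * (I - delta / 2)))] with [I]
    the information of the density. *)
Definition prodA1 (v : V^n) (x2 : X2^n) (y : Y^n) : R :=
  (\prod_i dA1 (tnth v i) (tnth x2 i) (tnth y i)) * c.
Definition prodA2 (v : V^n) (x2 : X2^n) (y : Y^n) : R :=
  (\prod_i dA2 (tnth v i) (tnth x2 i) (tnth y i)) * c.
Definition prodA3 (v : V^n) (x2 : X2^n) (y : Y^n) : R :=
  (\prod_i dA3 (tnth v i) (tnth x2 i) (tnth y i)) * c.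
Definition prodC1 (v : V^n) (x1 : X1^n) : R :=
  (\prod_i dC1 (tnth v i) (tnth x1 i)) * c.
Definition prodC2 (u : U^n) (v : V^n) (x1 : X1^n) : R :=
  (\prod_i dC2 (tnth u i) (tnth v i) (tnth x1 i)) * c.
Definition prodB1 (v : V^n) (y : Y^n) : R :=
  (\prod_i dB1 (tnth v i) (tnth y i)) * c.
Definition prodB2 (v : V^n) (x1 : X1^n) (x2 : X2^n) (y : Y^n) : R :=
  (\prod_i dB2 (tnth v i) (tnth x1 i) (tnth x2 i) (tnth y i)) * c.
Definition prodB3 (u : U^n) (v : V^n) (x1 : X1^n) (x2 : X2^n) (y : Y^n) : R :=
  (\prod_i dB3 (tnth u i) (tnth v i) (tnth x1 i) (tnth x2 i) (tnth y i)) * c.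

Let law_ge0 := joint_law_ge0 hU hV hX1 hX2 hX2c hW.

Let sum_ge0 (A : finType) (p F : A -> R) :
  is_pmf p -> (forall a, 0 <= F a) -> 0 <= \sum_a p a * F a.
Proof. by move=> [p0 _] F0; apply: sumr_ge0 => a _; rewrite mulr_ge0. Qed.

Lemma rival_prodA1 :
  \sum_t lawN t * (\sum_v power_law PV v * prodA1 v (rvX2 t) (rvY t)) <= c.
Proof.
apply: (rival_product (G := fun t => \sum_v PV v * dA1 v (rvX2 t) (rvY t))) => // [t||t].
- by apply: sum_ge0 => // v; exact: cmi_density_ge0.
- exact: rival_A1.
rewrite /prodA1; cbv beta; under [LHS]eq_bigr => ? _ do rewrite mulrA.
rewrite -big_distrl /= (sum_tuple_prodM (fun=> PV) (fun i v =>
  dA1 v (tnth (rvX2 (unzip7 t)) i) (tnth (rvY (unzip7 t)) i))).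
by congr (_ * _); apply: eq_bigr => i _; rewrite !tnth_mktuple.
Qed.

Lemma rival_prodA2 :
  \sum_t lawN t * (\sum_x2 power_law PX2 x2 * prodA2 (rvV t) x2 (rvY t)) <= c.
Proof.
apply: (rival_product (G := fun t => \sum_x2 PX2 x2 * dA2 (rvV t) x2 (rvY t))) => // [t||t].
- by apply: sum_ge0 => // v; exact: cmi_density_ge0.
- exact: rival_A2.
rewrite /prodA2; cbv beta; under [LHS]eq_bigr => ? _ do rewrite mulrA.
rewrite -big_distrl /= (sum_tuple_prodM (fun=> PX2) (fun i x2 =>
  dA2 (tnth (rvV (unzip7 t)) i) x2 (tnth (rvY (unzip7 t)) i))).
by congr (_ * _); apply: eq_bigr => i _; rewrite !tnth_mktuple.
Qed.

Lemma rival_prodA3 : \sum_t lawN t * (\sum_v power_law PV v *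
  (\sum_x2 power_law PX2 x2 * prodA3 v x2 (rvY t))) <= c.
Proof.
apply: (rival_product (G := fun t => \sum_v PV v * (\sum_x2 PX2 x2 * dA3 v x2 (rvY t))))
  => // [t||t].
- apply: sum_ge0 => // v; apply: sum_ge0 => // x2; exact: mi_density_ge0.
- exact: rival_A3.
rewrite /prodA3; cbv beta; under [LHS]eq_bigr => v _ do under eq_bigr do rewrite mulrA.
under [LHS]eq_bigr => v _ do rewrite -big_distrl /= (sum_tuple_prodM (fun=> PX2) (fun i x2 =>
  dA3 (tnth v i) x2 (tnth (rvY (unzip7 t)) i))) mulrA.
rewrite -big_distrl /= (sum_tuple_prodM (fun=> PV) (fun i v => \sum_x2 PX2 x2 *
  dA3 v x2 (tnth (rvY (unzip7 t)) i))).
by congr (_ * _); apply: eq_bigr => i _; rewrite !tnth_mktuple.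
Qed.

Lemma rival_prodC1 :
  \sum_t lawN t * (\sum_v power_law PV v * prodC1 v (rvX1 t)) <= c.
Proof.
apply: (rival_product (G := fun t => \sum_v PV v * dC1 v (rvX1 t))) => // [t||t].
- by apply: sum_ge0 => // v; exact: mi_density_ge0.
- exact: rival_C1.
rewrite /prodC1; cbv beta; under [LHS]eq_bigr => ? _ do rewrite mulrA.
rewrite -big_distrl /= (sum_tuple_prodM (fun=> PV) (fun i v =>
  dC1 v (tnth (rvX1 (unzip7 t)) i))).
by congr (_ * _); apply: eq_bigr => i _; rewrite !tnth_mktuple.
Qed.

Lemma densC2_ge0 u v x1 : 0 <= dC2 u v x1.
Proof. by rewrite invr_ge0 divr_ge0 ?prob_ge0. Qed.

Lemma rival_prodC2 : \sum_t lawN t *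
  (power_X1 (rvU t, rvV t) (rvX1 t) * prodC2 (rvU t) (rvV t) (rvX1 t)) <= c.
Proof.
apply: (rival_product (G := fun t => PX1 (rvU t, rvV t) (rvX1 t) *
  dC2 (rvU t) (rvV t) (rvX1 t))) => // [t||t].
- by rewrite mulr_ge0 ?(hX1 _).1 ?densC2_ge0.
- exact: rival_C2.
rewrite /prodC2 /power_X1; cbv beta; rewrite mulrA -big_split /=.
by congr (_ * _); apply: eq_bigr => i _; rewrite !tnth_mktuple.
Qed.

Lemma rival_prodB1 :
  \sum_t lawN t * (\sum_v power_law PV v * prodB1 v (rvYc t)) <= c.
Proof.
apply: (rival_product (G := fun t => \sum_v PV v * dB1 v (rvYc t))) => // [t||t].
- by apply: sum_ge0 => // v; exact: mi_density_ge0.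
- exact: rival_B1.
rewrite /prodB1; cbv beta; under [LHS]eq_bigr => ? _ do rewrite mulrA.
rewrite -big_distrl /= (sum_tuple_prodM (fun=> PV) (fun i v =>
  dB1 v (tnth (rvYc (unzip7 t)) i))).
by congr (_ * _); apply: eq_bigr => i _; rewrite !tnth_mktuple.
Qed.

Lemma rival_prodB2 : \sum_t lawN t * (\sum_u power_law PU u *
  (\sum_x1 power_X1 (u, rvV t) x1 *
    (\sum_xc power_X2c u xc * prodB2 (rvV t) x1 xc (rvYc t)))) <= c.
Proof.
apply: (rival_product (G := fun t => \sum_u PU u * (\sum_x1 PX1 (u, rvV t) x1 *
  (\sum_xc PX2c u xc * dB2 (rvV t) x1 xc (rvYc t))))) => // [t||t].
- apply: sum_ge0 => // u; apply: sum_ge0 => // x1; apply: sum_ge0 => // xc.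
  exact: cmi_density_ge0.
- exact: rival_B2.
rewrite /prodB2; cbv beta.
under [LHS]eq_bigr => u _ do under eq_bigr => x1 _ do under eq_bigr do rewrite mulrA.
under [LHS]eq_bigr => u _ do under eq_bigr => x1 _ do
  rewrite -big_distrl /= (sum_tuple_prodM (fun i => PX2c (tnth u i)) (fun i xc =>
  dB2 (tnth (rvV (unzip7 t)) i) (tnth x1 i) xc (tnth (rvYc (unzip7 t)) i))) mulrA.
under [LHS]eq_bigr => u _ do
  rewrite -big_distrl /= (sum_tuple_prodM
    (fun i => PX1 (tnth u i, tnth (rvV (unzip7 t)) i)) (fun i x1 =>
    \sum_xc PX2c (tnth u i) xc *
    dB2 (tnth (rvV (unzip7 t)) i) x1 xc (tnth (rvYc (unzip7 t)) i))) mulrA.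
rewrite -big_distrl /= (sum_tuple_prodM (fun=> PU) (fun i u =>
  \sum_x1 PX1 (u, tnth (rvV (unzip7 t)) i) x1 * (\sum_xc PX2c u xc *
    dB2 (tnth (rvV (unzip7 t)) i) x1 xc (tnth (rvYc (unzip7 t)) i)))).
by congr (_ * _); apply: eq_bigr => i _; rewrite !tnth_mktuple.
Qed.

Lemma rival_prodB3 : \sum_t lawN t * (\sum_xc power_X2c (rvU t) xc *
    prodB3 (rvU t) (rvV t) (rvX1 t) xc (rvYc t)) <= c.
Proof.
apply: (rival_product (G := fun t => \sum_xc PX2c (rvU t) xc *
  dB3 (rvU t) (rvV t) (rvX1 t) xc (rvYc t))) => // [t||t].
- by apply: sum_ge0 => // v; exact: cmi_density_ge0.
- exact: rival_B3.
rewrite /prodB3; cbv beta; under [LHS]eq_bigr => ? _ do rewrite mulrA.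
rewrite -big_distrl /= (sum_tuple_prodM (fun i => PX2c (tnth (rvU (unzip7 t)) i))
  (fun i xc => dB3 (tnth (rvU (unzip7 t)) i) (tnth (rvV (unzip7 t)) i)
    (tnth (rvX1 (unzip7 t)) i) xc (tnth (rvYc (unzip7 t)) i))).
by congr (_ * _); apply: eq_bigr => i _; rewrite !tnth_mktuple.
Qed.

End ProductLaws.

(** * Block-Markov coding *)

Section BlockCode.
Context {R : realType} {X1 X2 Y : finType}.
Variable W : X1 -> X2 -> Y -> R.
Hypothesis hW : is_mac W.

(** [ma] and [m'] form the final state, so [Mb] is the only message of Encoder 1 and its second
    message set is trivial. Encoder 2 uses its initial state and ignores the symbols of the current
    block, which makes causality immediate. *)
Lemma has_code_of_block_fail n (Ka Kb Mb M2 Mc : finType)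
    (x1 : (Ka * Kb) * (Ka * Mb) * Kb -> n.-tuple X1) (x2 : M2 -> n.-tuple X2)
    (xc : (Ka * Kb) * Mc -> n.-tuple X2) gA gC gB (e : R) :
  \sum_i block_fail (@mac_law R X1 X2 Y W n) x1 x2 xc gA gC gB i <=
    #|{: (Ka * Kb) * (Ka * Mb) * Kb * M2 * Mc}|%:R * e ->
  has_code W n Ka Kb e #|Mb|%:R 1 #|M2|%:R #|Mc|%:R.
Proof.
move=> le; exists Mb, unit, M2, Mc.
exists (OpenCode (Ka := Ka) (Kb := Kb) (M1' := unit) (oenc2c := fun k m _ => xc (k, m))
  (fun k l m _ => x1 (k, (l.1, m), l.2)) x2 gC
  (fun y => let d := gA y in ((d.1.2, d.2), d.1.1))
  (fun y l => let d := gB y l in (d.1.1, tt, d.2, d.1.2))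
  (fun _ _ _ _ _ _ => erefl)); split; first by rewrite card_unit.
pose f (s : (Ka * Kb) * (Ka * Kb) * Mb * unit * M2 * Mc) :
    ((Ka * Kb) * (Ka * Mb) * Kb * M2 * Mc) * unit :=
  let: (k, (la, lb), m, _, m2, mc) := s in ((k, (la, m), lb, m2, mc), tt).
have bf : bijective f.
  exists (fun s => let: ((k, (la, m), lb, m2, mc), _) := s in
    (k, (la, lb), m, tt, m2, mc)).
    by move=> [[[[[k [la lb]] m] []] m2] mc].
  by move=> [[[[[k [la m]] lb] m2] mc] []].
rewrite mulrC in le; apply: le_trans (mean_proj bf le); apply: ler_sum.
move=> [[[[[k [la lb]] m] []] m2] mc] _; rewrite /open_fail /block_fail /=.
apply: lerD; first apply: lerD => //.
  apply: (error_prob_sub hW) => y /=; case: (gA y) => -[a b] d /=.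
  by apply: contra => /eqP[-> -> ->].
apply: (error_prob_sub hW) => y /=; case: (gB y _) => -[a b] d /=.
by apply: contra => /eqP[-> -> ->].
Qed.

End BlockCode.

(* The case [m = 1] is kept apart because the message then has no rival, and the
   slack [delta] is not available at rate 0. *)
Definition rated (R : realType) (n : nat) (delta rho : R) (m : nat) : Prop :=
  m%:R <= expR (n%:R * rho) /\ (m = 1%N \/ m%:R <= expR (n%:R * (rho - delta))).

Section Rated.
Context {R : realType}.

(** One nontrivial factor provides the slack for the product; the bound without slack in [rated]
    takes care of the other factor. *)
Lemma ratedM (n : nat) (delta rho rho' : R) m m' :
  rated n delta rho m -> rated n delta rho' m' -> rated n delta (rho + rho') (m * m').
Proof.
move=> [h1 h2] [h1' h2']; split; first by rewrite natrM mulrDr expRD ler_pM.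
case: h2 => [m1|h2]; last first.
  by right; rewrite natrM addrAC mulrDr expRD ler_pM.
subst m; case: h2' => [->|h2']; first by left.
by right; rewrite natrM -addrA mulrDr expRD ler_pM.
Qed.

(** Of the slack [delta], one half is spent on the threshold and the other half makes the bound
    decay. *)
Lemma rated_rivals (n : nat) (delta rho I : R) m : 0 < delta -> rho <= I ->
  rated n delta rho m ->
  m.-1%:R * expR (- (n%:R * (I - delta / 2))) <= expR (- (n%:R * (delta / 2))).
Proof.
move=> delta0 rhoI [_ [->|le]]; first by rewrite mul0r expR_ge0.
have {}le : m.-1%:R <= expR (n%:R * (rho - delta)).
  by apply: le_trans le; rewrite ler_nat leq_pred.
apply: (le_trans (ler_wpM2r (expR_ge0 _) le)); rewrite -expRD ler_expR.
have := ler_wpM2l (ler0n R n) rhoI; lra.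
Qed.

(** One [delta] is the slack of [rated], the other pays for rounding to an integer. If [rho] is at
    most [delta], a single message is enough. *)
Lemma rated_exists (n : nat) (delta rho : R) :
  0 <= rho -> 0 < delta -> 1 <= n%:R * delta ->
  exists m, [/\ (0 < m)%N, rated n delta rho m & expR (n%:R * (rho - 2 * delta)) <= m%:R].
Proof.
move=> rho0 delta0 nd; have n0 : 0 <= n%:R :> R by [].
have [le|lt] := leP rho delta.
  exists 1%N; split=> //.
    by split; [rewrite -[X in X <= _]expR0 ler_expR mulr_ge0|left].
  rewrite -[leRHS]expR0 ler_expR; apply: mulr_ge0_le0 => //; lra.
have e1 : 1 <= expR (n%:R * (rho - delta)).
  by rewrite -[X in X <= _]expR0 ler_expR mulr_ge0 // subr_ge0 ltW.
pose m := Num.truncn (expR (n%:R * (rho - delta))).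
have m0 : (0 < m)%N by rewrite truncn_gt0.
have mle : m%:R <= expR (n%:R * (rho - delta)) by rewrite truncn_le expR_ge0.
exists m; split=> //.
  split; last by right.
  apply: (le_trans mle); rewrite ler_expR ler_wpM2l //; lra.
have : expR (n%:R * (rho - delta)) < m.+1%:R := truncnS_gt _.
have m1 : 1 <= m%:R :> R by rewrite ler1n.
have -> : n%:R * (rho - delta) = n%:R * (rho - 2 * delta) + n%:R * delta by ring.
rewrite expRD -natr1 => lt'.
(* Rounding down an integer part at least 1 loses at most a factor 2, as m + 1 <= 2 m. *)
have e2 : 2 <= expR (n%:R * delta).
  by apply: le_trans (expR_ge1Dx _); lra.
have := ler_wpM2l (expR_ge0 (n%:R * (rho - 2 * delta))) e2; lra.
Qed.

End Rated.

(** * Codes for one block at single-letter rates *)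

Section Asymptotics.
Context {R : realType} {U V X1 X2 Y : finType}.
Variables (PU : U -> R) (PV : V -> R) (PX1 : U * V -> X1 -> R)
  (PX2 : X2 -> R) (PX2c : U -> X2 -> R) (W : X1 -> X2 -> Y -> R).
Hypotheses (hU : is_pmf PU) (hV : is_pmf PV) (hX1 : is_kernel PX1)
  (hX2 : is_pmf PX2) (hX2c : is_kernel PX2c) (hW : is_mac W).
Local Notation omega := (U * V * X1 * X2 * X2 * Y * Y)%type.
Local Notation law := (joint_law PU PV PX1 PX2 PX2c W).

Lemma atypical_le n (r : omega -> R) (D : _ -> R) (c e : R) :
  (forall t : n.-tuple omega, D (unzip7 t) = (\prod_i r (tnth t i)) * c) ->
  \sum_(t : n.-tuple omega) power_law law t *
    ((\prod_i r (tnth t i)) * c < 1)%R%:R <= e ->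
  \sum_s lawN PU PV PX1 PX2 PX2c W s * (D s < 1)%R%:R <= e.
Proof.
move=> Dr; apply: le_trans; rewrite sum_lawN.
by apply: ler_sum => t _; rewrite Dr.
Qed.

Lemma block_codes (ra rb rm r2 rc eps delta : R) :
  0 <= ra -> 0 <= rb -> 0 <= rm -> 0 <= r2 -> 0 <= rc -> 0 < eps -> 0 < delta ->
  ra + rm <= `I[law](rvV ; rvY | rvX2) ->
  r2 <= `I[law](rvX2 ; rvY | rvV) ->
  ra + rm + r2 <= `I[law](rvpair rvV rvX2 ; rvY) ->
  ra + rm <= `I[law](rvV ; rvX1) ->
  rb <= `H[law](rvX1 | rvpair rvU rvV) ->
  rm <= `I[law](rvV ; rvYc) ->
  ra + rb + rc <= `I[law](rvpair rvX1 rvX2c ; rvYc | rvV) ->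
  rc <= `I[law](rvX2c ; rvYc | rvpair (rvpair rvU rvV) rvX1) ->
  \forall n \near \oo, exists Ka Kb : finType,
    [/\ (0 < #|Ka|)%N, (0 < #|Kb|)%N,
      expR (n%:R * (ra - 2 * delta)) <= #|Ka|%:R,
      expR (n%:R * (rb - 2 * delta)) <= #|Kb|%:R &
      has_code W n Ka Kb eps (expR (n%:R * (rm - 2 * delta))) 1
        (expR (n%:R * (r2 - 2 * delta))) (expR (n%:R * (rc - 2 * delta)))].
Proof.
move=> ra0 rb0 rm0 r20 rc0 eps0 delta0.
have lawP : is_pmf law.
  by split; [exact: joint_law_ge0|exact: joint_law_sum1].
rewrite !cond_mutual_info_mean ?cond_entropy_mean ?mutual_info_mean; try exact: lawP.1.
pose rA1 (t : omega) := densA1 PU PV PX1 PX2 PX2c W (rvV t) (rvX2 t) (rvY t).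
pose rA2 (t : omega) := densA2 PU PV PX1 PX2 PX2c W (rvV t) (rvX2 t) (rvY t).
pose rA3 (t : omega) := densA3 PU PV PX1 PX2 PX2c W (rvV t) (rvX2 t) (rvY t).
pose rC1 (t : omega) := densC1 PU PV PX1 PX2 PX2c W (rvV t) (rvX1 t).
pose rC2 (t : omega) := densC2 PU PV PX1 PX2 PX2c W (rvU t) (rvV t) (rvX1 t).
pose rB1 (t : omega) := densB1 PU PV PX1 PX2 PX2c W (rvV t) (rvYc t).
pose rB2 (t : omega) := densB2 PU PV PX1 PX2 PX2c W (rvV t) (rvX1 t) (rvX2c t) (rvYc t).
pose rB3 (t : omega) :=
  densB3 PU PV PX1 PX2 PX2c W (rvU t) (rvV t) (rvX1 t) (rvX2c t) (rvYc t).
pose info (r : omega -> R) := \sum_t law t * ln (r t).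
rewrite -/(info rA1) -/(info rA2) -/(info rA3) -/(info rC1).
rewrite -/(info rC2) -/(info rB1) -/(info rB2) -/(info rB3).
move=> leA1 leA2 leA3 leC1 leC2 leB1 leB2 leB3.
have d2 : 0 < delta / 2 by rewrite divr_gt0.
(* Eight scores, each with an atypicality term and a rival term. *)
have e16 : 0 < eps / 16 by rewrite divr_gt0.
pose atyp n r := \sum_(t : n.-tuple omega) power_law law t *
  ((\prod_i r (tnth t i)) * expR (- (n%:R * (info r - delta / 2))) < 1)%R%:R.
have wl r : (forall t, 0 < law t -> 0 < r t) ->
    \forall n \near \oo, atyp n r <= eps / 16.
  by move=> r0; exact: density_weak_law.
have wA1 : \forall n \near \oo, atyp n rA1 <= eps / 16.
  by apply: wl => t; apply: cmi_density_gt0; exact: lawP.1.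
have wA2 : \forall n \near \oo, atyp n rA2 <= eps / 16.
  by apply: wl => t; apply: cmi_density_gt0; exact: lawP.1.
have wA3 : \forall n \near \oo, atyp n rA3 <= eps / 16.
  by apply: wl => t lt; apply: (mi_density_gt0 lawP.1 (rvpair rvV rvX2) rvY lt).
have wC1 : \forall n \near \oo, atyp n rC1 <= eps / 16.
  by apply: wl => t; apply: mi_density_gt0; exact: lawP.1.
have wC2 : \forall n \near \oo, atyp n rC2 <= eps / 16.
  apply: wl => t lt; rewrite /rC2 /densC2 invr_gt0.
  exact: (condprob_gt0 lawP.1 rvX1 (rvpair rvU rvV) lt).
have wB1 : \forall n \near \oo, atyp n rB1 <= eps / 16.
  by apply: wl => t; apply: mi_density_gt0; exact: lawP.1.
have wB2 : \forall n \near \oo, atyp n rB2 <= eps / 16.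
  by apply: wl => t lt; apply: (cmi_density_gt0 lawP.1 (rvpair rvX1 rvX2c) rvYc rvV lt).
have wB3 : \forall n \near \oo, atyp n rB3 <= eps / 16.
  by apply: wl => t lt; apply: (cmi_density_gt0 lawP.1 rvX2c rvYc
    (rvpair (rvpair rvU rvV) rvX1) lt).
near=> n.
have [nA1 [nA2 [nA3 [nC1 [nC2 [nB1 [nB2 nB3]]]]]]] :
    atyp n rA1 <= eps / 16 /\
    atyp n rA2 <= eps / 16 /\
    atyp n rA3 <= eps / 16 /\
    atyp n rC1 <= eps / 16 /\
    atyp n rC2 <= eps / 16 /\
    atyp n rB1 <= eps / 16 /\
    atyp n rB2 <= eps / 16 /\
    atyp n rB3 <= eps / 16.
  by near: n; exact: (filterI wA1 (filterI wA2 (filterI wA3 (filterI wC1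
    (filterI wC2 (filterI wB1 (filterI wB2 wB3))))))).
have nd : 1 <= n%:R * delta.
  by rewrite -ler_pdivrMr //; near: n; exact: near_ge_natr.
have small : expR (- (n%:R * (delta / 2))) <= eps / 16.
  rewrite expRN invf_ple ?posrE ?expR_gt0 //.
  apply: le_trans (expR_ge1Dx _); rewrite ler_wpDl //.
  by rewrite -ler_pdivrMr //; near: n; exact: near_ge_natr.
have [ma [ma0 ma_rated ma_ge]] := rated_exists ra0 delta0 nd.
have [mb [mb0 mb_rated mb_ge]] := rated_exists rb0 delta0 nd.
have [mm [mm0 mm_rated mm_ge]] := rated_exists rm0 delta0 nd.
have [m2 [m20 m2_rated m2_ge]] := rated_exists r20 delta0 nd.
have [mc [mc0 mc_rated mc_ge]] := rated_exists rc0 delta0 nd.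
exists 'I_ma, 'I_mb; rewrite !card_ord; split=> //.
pose c (r : omega -> R) := expR (- (n%:R * (info r - delta / 2))).
have c0 r : 0 <= c r by exact: expR_ge0.
have prod_ge0 (F : 'I_n -> R) r : (forall i, 0 <= F i) -> 0 <= (\prod_i F i) * c r.
  by move=> F0; rewrite mulr_ge0 // prodr_ge0.
have law_ge0 := lawP.1.
have gA1 v x2 y : 0 <= @prodA1 R U V X1 X2 Y PU PV PX1 PX2 PX2c W n (c rA1) v x2 y.
  by apply: prod_ge0 => i; exact: cmi_density_ge0.
have gA2 v x2 y : 0 <= @prodA2 R U V X1 X2 Y PU PV PX1 PX2 PX2c W n (c rA2) v x2 y.
  by apply: prod_ge0 => i; exact: cmi_density_ge0.
have gA3 v x2 y : 0 <= @prodA3 R U V X1 X2 Y PU PV PX1 PX2 PX2c W n (c rA3) v x2 y.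
  by apply: prod_ge0 => i; exact: mi_density_ge0.
have gC1 v x1 : 0 <= @prodC1 R U V X1 X2 Y PU PV PX1 PX2 PX2c W n (c rC1) v x1.
  by apply: prod_ge0 => i; exact: mi_density_ge0.
have gC2 u v x1 : 0 <= @prodC2 R U V X1 X2 Y PU PV PX1 PX2 PX2c W n (c rC2) u v x1.
  by apply: prod_ge0 => i; exact: densC2_ge0.
have gB1 v y : 0 <= @prodB1 R U V X1 X2 Y PU PV PX1 PX2 PX2c W n (c rB1) v y.
  by apply: prod_ge0 => i; exact: mi_density_ge0.
have gB2 v x1 x2 y : 0 <= @prodB2 R U V X1 X2 Y PU PV PX1 PX2 PX2c W n (c rB2) v x1 x2 y.
  by apply: prod_ge0 => i; exact: cmi_density_ge0.
have gB3 u v x1 x2 y : 0 <= @prodB3 R U V X1 X2 Y PU PV PX1 PX2 PX2c W n (c rB3) u v x1 x2 y.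
  by apply: prod_ge0 => i; exact: cmi_density_ge0.
have [x1 [x2 [xc [dA [dC [dB le]]]]]] :=
  one_shot (power_law_pmf n hU) (power_law_pmf n hV) (@power_X1_kernel _ _ _ _ _ hX1 n)
  (power_law_pmf n hX2) (@power_X2c_kernel _ _ _ _ hX2c n) (mac_law_pmf hW (n := n))
  (Ka := 'I_ma) (Kb := 'I_mb) (Mb := 'I_mm) (M2 := 'I_m2) (Mc := 'I_mc)
  gA1 gA2 gA3 gC1 gC2 gB1 gB2 gB3
  (rival_prodA1 hU hV hX1 hX2 hX2c hW n (c0 rA1))
  (rival_prodA2 hU hV hX1 hX2 hX2c hW n (c0 rA2))
  (rival_prodA3 hU hV hX1 hX2 hX2c hW n (c0 rA3))
  (rival_prodC1 hU hV hX1 hX2 hX2c hW n (c0 rC1))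
  (rival_prodC2 hU hV hX1 hX2 hX2c hW n (c0 rC2))
  (rival_prodB1 hU hV hX1 hX2 hX2c hW n (c0 rB1))
  (rival_prodB2 hU hV hX1 hX2 hX2c hW n (c0 rB2))
  (rival_prodB3 hU hV hX1 hX2 hX2c hW n (c0 rB3))
  (c0 rA3) (c0 rB2) (Ordinal ma0) (Ordinal mb0) (Ordinal mm0) (Ordinal m20) (Ordinal mc0).
have w (r : omega -> R) D : atyp n r <= eps / 16 ->
    (forall t : n.-tuple omega, D (unzip7 t) = (\prod_i r (tnth t i)) * c r) ->
    \sum_s lawN PU PV PX1 PX2 PX2c W s * (D s < 1)%R%:R <= eps / 16.
  by move=> h Dr; exact: (atypical_le Dr h).
have := has_code_of_block_fail hW le; rewrite !card_ord.
apply: has_code_mono => //.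
have -> : eps = eps / 16 *+ 16 by rewrite -mulr_natr -mulrA mulVf ?mulr1.
rewrite /atypical_prob /rivals_bound !card_prod !card_ord.
have am := ratedM ma_rated mm_rated.
have am2 := ratedM am m2_rated.
have abc := ratedM (ratedM ma_rated mb_rated) mc_rated.
have v r m rho (h : rho <= info r) (hm : rated n delta rho m) :
    m.-1%:R * c r <= eps / 16.
  exact: le_trans (rated_rivals delta0 h hm) small.
have uA1 := v _ _ _ leA1 am.
have uA2 := v _ _ _ leA2 m2_rated.
have uA3 := v _ _ _ leA3 am2.
have uC1 := v _ _ _ leC1 am.
have uC2 := v _ _ _ leC2 mb_rated.
have uB1 := v _ _ _ leB1 mm_rated.
have uB2 := v _ _ _ leB2 abc.
have uB3 := v _ _ _ leB3 mc_rated.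
have unz F G r : (forall i, F i = G i) -> (\prod_(i < n) F i) * c r = (\prod_i G i) * c r.
  by move=> FG; congr (_ * _); apply: eq_bigr.
pose T (D : _ -> R) := \sum_s lawN PU PV PX1 PX2 PX2c W (n := n) s * (D s < 1)%R%:R.
have tA1 : T (fun s => prodA1 PU PV PX1 PX2 PX2c W (c rA1)
  (rvV s) (rvX2 s) (rvY s)) <= eps / 16.
  apply: (w rA1) => [|t]; first exact: nA1.
  by apply: unz => i; rewrite !tnth_mktuple.
have tA2 : T (fun s => prodA2 PU PV PX1 PX2 PX2c W (c rA2)
  (rvV s) (rvX2 s) (rvY s)) <= eps / 16.
  apply: (w rA2) => [|t]; first exact: nA2.
  by apply: unz => i; rewrite !tnth_mktuple.
have tA3 : T (fun s => prodA3 PU PV PX1 PX2 PX2c W (c rA3)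
  (rvV s) (rvX2 s) (rvY s)) <= eps / 16.
  apply: (w rA3) => [|t]; first exact: nA3.
  by apply: unz => i; rewrite !tnth_mktuple.
have tC1 : T (fun s => prodC1 PU PV PX1 PX2 PX2c W (c rC1) (rvV s) (rvX1 s)) <= eps / 16.
  apply: (w rC1) => [|t]; first exact: nC1.
  by apply: unz => i; rewrite !tnth_mktuple.
have tC2 : T (fun s => prodC2 PU PV PX1 PX2 PX2c W (c rC2)
  (rvU s) (rvV s) (rvX1 s)) <= eps / 16.
  apply: (w rC2) => [|t]; first exact: nC2.
  by apply: unz => i; rewrite !tnth_mktuple.
have tB1 : T (fun s => prodB1 PU PV PX1 PX2 PX2c W (c rB1) (rvV s) (rvYc s)) <= eps / 16.
  apply: (w rB1) => [|t]; first exact: nB1.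
  by apply: unz => i; rewrite !tnth_mktuple.
have tB2 : T (fun s => prodB2 PU PV PX1 PX2 PX2c W (c rB2) (rvV s) (rvX1 s)
  (rvX2c s) (rvYc s)) <= eps / 16.
  apply: (w rB2) => [|t]; first exact: nB2.
  by apply: unz => i; rewrite !tnth_mktuple.
have tB3 : T (fun s => prodB3 PU PV PX1 PX2 PX2c W (c rB3) (rvU s) (rvV s) (rvX1 s)
  (rvX2c s) (rvYc s)) <= eps / 16.
  apply: (w rB3) => [|t]; first exact: nB3.
  by apply: unz => i; rewrite !tnth_mktuple.
rewrite [leRHS] (_ : _ = (eps / 16 + eps / 16 + eps / 16 + (eps / 16 + eps / 16) +
  (eps / 16 + eps / 16 + eps / 16)) + (eps / 16 + eps / 16 + eps / 16 +
  (eps / 16 + eps / 16) + (eps / 16 + eps / 16 + eps / 16))); last by ring.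
have {uA1 uA2 uA3 uC1 uC2 uB1 uB2 uB3} u :=
  lerD (lerD (lerD (lerD uA1 uA2) uA3) (lerD uC1 uC2)) (lerD (lerD uB1 uB2) uB3).
apply: lerD; last exact: u.
exact: (lerD (lerD (lerD (lerD tA1 tA2) tA3) (lerD tC1 tC2)) (lerD (lerD tB1 tB2) tB3)).
Unshelve. all: by end_near. Qed.

End Asymptotics.

Lemma pmf_inhabited (R : realType) (A : finType) (p : A -> R) : is_pmf p -> inhabited A.
Proof.
move=> [_ p1]; case: (pickP (predT : pred A)) => [a _|A0]; first exact: inhabits a.
by move: p1; rewrite big_pred0 // => /esym/eqP; rewrite oner_eq0.
Qed.

(** * Rate splitting and the number of blocks *)

Section SingleLetterCoded.
Context {R : realType} {X1 X2 Y : finType}.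
Variable W : X1 -> X2 -> Y -> R.
Hypothesis hW : is_mac W.

(** [B + 1] blocks carry only [B] states as messages. The missing [ra] is at most half of
    [(B + 1) * gamma], and the two rate losses of [gamma / 4] fit into the other half. *)
Lemma block_rate (B N : nat) (gamma ra rm a b : R) : 0 <= ra ->
  2 * ra / gamma <= B.+1%:R -> 0 < gamma ->
  expR (N%:R * (rm - 2 * (gamma / 8))) <= a ->
  expR (N%:R * (ra - 2 * (gamma / 8))) <= b ->
  expR ((B.+1 * N)%N%:R * (ra + rm - gamma)) <= a ^+ B.+1 * b ^+ B.
Proof.
move=> ra0 Bra gamma0 ha hb.
have ea := expR_ge0 (N%:R * (rm - 2 * (gamma / 8))).
have eb := expR_ge0 (N%:R * (ra - 2 * (gamma / 8))).
apply: (@le_trans _ _ (expR (N%:R * (rm - 2 * (gamma / 8))) ^+ B.+1 *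
    expR (N%:R * (ra - 2 * (gamma / 8))) ^+ B)); last first.
  by apply: ler_pM; rewrite ?exprn_ge0 // lerXn2r ?nnegrE // (le_trans _ ha, le_trans _ hb).
rewrite -!expRM_natl -expRD ler_expR natrM.
move: Bra; rewrite ler_pdivrMr // => Bra.
have h1 : 0 <= N%:R * (B.+1%:R * gamma - 2 * ra) by rewrite mulr_ge0 // subr_ge0.
have h2 : 0 <= N%:R * gamma by rewrite mulr_ge0 // ltW.
move: h1; rewrite -natr1 => h1; lra.
Qed.

Lemma single_letter_coded r : single_letter_rates W r -> coded_rates W r.
Proof.
case: r => [[[R1 R1'] R2] R2c] [r0 [U [V [P [_ _ [PU [PV [PX1 [PX2 [PX2c
  [[hU hV hX1 hX2 hX2c] PE]]]]]]]]]]].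
have -> : P = joint_law PU PV PX1 PX2 PX2c W.
  by apply/funext => -[[[[[[u v] x1] x2] xc] y] yc]; exact: PE.
set P' := joint_law _ _ _ _ _ _ => {P PE}.
move=> [[leA1 leA2 leA3] leC2 leB3 leB2 leB].
have [u] := pmf_inhabited hU; have [v] := pmf_inhabited hV.
have [x0] := pmf_inhabited (hX1 (u, v)); have [z0] := pmf_inhabited hX2.
have P_ge0 := joint_law_ge0 hU hV hX1 hX2 hX2c hW.
have P_sum1 := joint_law_sum1 hU hV hX1 hX2 hX2c hW.
have leC1 := le_trans leA1 (data_processing hU hV hX1 hX2 hX2c hW).
have chain := chain_rule hU hV hX1 hX2 hX2c hW.
have IV_ge0 := mutual_info_ge0 P_ge0 P_sum1 rvV rvYc.
rewrite -/P' in P_ge0 P_sum1 leC1 chain IV_ge0.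
case: (r0) => R1_ge0 R1'_ge0 R2_ge0 R2c_ge0.
set IB := `I[P'](rvpair rvX1 rvX2c ; rvYc | rvV) in leB2 chain.
set IV := `I[P'](rvV ; rvYc) in IV_ge0 chain.
(* Part of [R1], of rate [rm], is not conveyed to Encoder 2 through the next
   block; the decoder recovers it first, from [V] alone. *)
pose rm := Num.max 0 (R1 + R1' + R2c - IB); pose ra := R1 - rm.
have rm0 : 0 <= rm by rewrite le_max lexx.
have rmR : R1 + R1' + R2c - IB <= rm by rewrite le_max lexx orbT.
have rmV : rm <= IV by rewrite ge_max IV_ge0 /=; lra.
(* This is where R1' + R2c <= I(X1,X2c;Yc|V) enters. *)
have ra0 : 0 <= ra by rewrite subr_ge0 ge_max R1_ge0 /=; lra.
have ram : ra + rm = R1 by rewrite /ra subrK.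
apply: (coded_rates_of_blocks hW x0 z0) => // eps gamma eps0 gamma0.
(* With this many blocks, the state lost at the end costs at most [gamma / 2] per letter, for [ra]
   as well as for [R1']. *)
pose B := Num.truncn (2 * (ra + R1') / gamma).
have Bge : 2 * (ra + R1') / gamma <= B.+1%:R by apply/ltW/truncnS_gt.
have leB_of x : 0 <= x -> x <= ra + R1' -> 2 * x / gamma <= B.+1%:R.
  move=> x0' xle; apply: le_trans Bge.
  by rewrite ler_pM2r ?invr_gt0 // ler_pM2l.
have Ba : 2 * ra / gamma <= B.+1%:R by apply: leB_of => //; rewrite lerDl.
have Bb : 2 * R1' / gamma <= B.+1%:R by apply: leB_of => //; rewrite lerDr.
have B0 : 0 < 2 * B.+1%:R :> R by rewrite mulr_gt0.
(* Compensates the factor by which [has_code_iter] multiplies the error. *)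
have eps1 : 0 < eps / (2 * B.+1%:R) by rewrite divr_gt0.
have delta0 : 0 < gamma / 8 by rewrite divr_gt0.
exists B.+1 => //.
rewrite -ram in leA1 leA3 leC1.
have leB2' : ra + R1' + R2c <= IB by rewrite /ra; lra.
have [N0 _ codes] := block_codes hU hV hX1 hX2 hX2c hW ra0 R1'_ge0 rm0 R2_ge0 R2c_ge0
  eps1 delta0 leA1 leA2 leA3 leC1 leC2 rmV leB2' leB3.
exists N0 => // N /codes [Ka [Kb [Ka0 Kb0 ge_a ge_b code]]].
apply: (has_code_close hW Ka0 Kb0).
apply: has_code_mono (has_code_iter hW B _ _ _ _ _ code); rewrite ?expR_ge0 ?(ltW eps1) //.
- by rewrite mulrC divfK // gt_eqF.
- by rewrite -ram; apply: block_rate.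
(* [R1'] is carried by the states alone, so [rm] is 0 here; for [R2] and [R2c] below the states
   contribute nothing and [ra] is 0. *)
- rewrite -[X in X - gamma]addr0; apply: block_rate => //.
  by rewrite sub0r -[leRHS]expR0 ler_expR mulr_ge0_le0 // oppr_le0 mulr_ge0 // ltW.
- rewrite -[leRHS]mulr1 -[X in _ <= _ * X] (expr1n _ B) -[X in X - gamma]add0r.
  apply: block_rate => //; first by rewrite mulr0 mul0r.
  by rewrite sub0r -[leRHS]expR0 ler_expR mulr_ge0_le0 // oppr_le0 mulr_ge0 // ltW.
- rewrite -[leRHS]mulr1 -[X in _ <= _ * X] (expr1n _ B) -[X in X - gamma]add0r.
  apply: block_rate => //; first by rewrite mulr0 mul0r.
  by rewrite sub0r -[leRHS]expR0 ler_expR mulr_ge0_le0 // oppr_le0 mulr_ge0 // ltW.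
Qed.

End SingleLetterCoded.

Theorem theorem2 (R : realType) (X1 X2 Y : finType) (W : X1 -> X2 -> Y -> R)
    (hW : is_mac W) :
  inner_region W `<=` capacity_region W.
Proof.
move=> r r_inner; apply: subset_closure; apply: coded_rates_achievable => //.
move: r r_inner; apply: smallest_sub; first exact: coded_rates_convex.
exact: single_letter_coded.
Qed.
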